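(* As $m\to\infty$, \[ r_m^{(3)}(K_{3,3})=\left(\frac12+o(1)\right)m^3. \]
   Context: For integers $m\ge 1$ and $k\ge 2$ and a graph $H$, $r_m^{(k)}(H)$ denotes the least $n$ such that every coloring of the edges of the complete $k$-partite graph $K_{n,\dots,n}$ (with $k$ parts of size $n$ each) with $m$ colors yields a monochromatic copy of $H$, i.e. a (not necessarily induced) subgraph isomorphic to $H$ all of whose edges have the same color. $K_{3,3}$ is the complete bipartite graph with both sides of size $3$. Here $o(1)$ denotes a quantity tending to $0$ as $m\to\infty$. *)

(* Defs.v *)
From HB Require Import structures.
From mathcomp Require Import all_boot all_order all_algebra.
From mathcomp Require Import all_classical all_reals all_analysis.

Set Implicit Arguments.
Unset Strict Implicit.
Unset Printing Implicit Defensive.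

Record sgraph := SGraph {
  vertex : finType;
  adj : rel vertex;
  adj_sym : symmetric adj;
  adj_irr : irreflexive adj }.

Definition edges (G : sgraph) : {set {set vertex G}} :=
  [set [set p.1; p.2] | p : vertex G * vertex G & adj p.1 p.2].

Definition edge (G : sgraph) : Type := {e : {set vertex G} | e \in edges G}.

Section CompleteMultipartite.
Variables k n : nat.

(* The vertex [(i, x)] is the [x]-th vertex of the [i]-th part. *)
Definition multipartite_adj : rel ('I_k * 'I_n) := fun u v => u.1 != v.1.

Lemma multipartite_adj_sym : symmetric multipartite_adj.
Proof. by move=> u v; rewrite /multipartite_adj eq_sym. Qed.

Lemma multipartite_adj_irr : irreflexive multipartite_adj.
Proof. by move=> u; rewrite /multipartite_adj eqxx. Qed.

Definition complete_multipartite : sgraph :=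
  SGraph multipartite_adj_sym multipartite_adj_irr.

End CompleteMultipartite.

Definition K33 : sgraph := complete_multipartite 2 3.

(* A copy of [H] in [G] is the image of an injective map sending edges of [H]
   to edges of [G]; it need not be induced. *)
Definition mono_copy (G H : sgraph) (m : nat) (c : edge G -> 'I_m) : Prop :=
  exists f : vertex H -> vertex G, injective f /\
    exists a : 'I_m, forall e : edge H,
      exists2 e' : edge G, val e' = f @: val e & c e' = a.

Definition multipartite_arrows (k m : nat) (H : sgraph) (n : nat) : Prop :=
  forall c : edge (complete_multipartite k n) -> 'I_m, mono_copy H c.

(* Equal to [0] by convention if no [n] has the property (for instance if [H]
   is not [k]-colorable). *)
Definition multipartite_ramsey (k m : nat) (H : sgraph) : nat :=
  xget 0%N [set n | multipartite_arrows k m H n /\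
    forall n', multipartite_arrows k m H n' -> (n <= n')%N]%classic.

(* Main.v *)
(** Upper bound.  If K_{n,n,n} is coloured with [m] colours, some colour class
between the first part and the 2n vertices of the other two parts has density at
least 1/m.  In Füredi's manner, fix a vertex [w] on the large side: as the class
contains no K_{3,3}, a triple of neighbours of [w] has at most one other common
neighbour, so the cubes of the codegrees of [w] sum to at most deg(w)^3.
Convexity then gives 2n <= m^3 + O(m^2).

Lower bound.  Let [q] be an odd prime power and let N : GF(q^2) -> GF(q) be the
norm.  In the projective norm graph, (A,a) ~ (B,b) iff N(A+B) = ab, three vertices
have at most two common neighbours.  Let I^2 = -1 and choose [P] with
GF(q^2)^* = P ⊔ -P.  Every part is P × GF(q)^*, and the edge from (u,x) in part [j]
to (v,y) in part [j+1] gets the colour N(u - Iv)/(xy).  Seen from (u,x), the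
neighbours (v,y) in part [j+1] and (w,z) in part [j-1] behave as the points
(-Iv, y) and (Iw, z/N(-I)) of one projective norm graph, and these are distinct
because -P and P are disjoint.  The edges with u = Iv form copies of
K_{q-1,q-1}, coloured without K_{2,2} by o(q) further colours.  This uses
(1+o(1))q colours and parts of size (1/2+o(1))q^3.

It remains to find an odd prime power in ((1-ε)m, m] for large [m].  This follows
Erdős: Selberg's formula
ψ(x) log x + ∑_{n<=x} Λ(n) ψ(x/n) = 2 x log x + O(x) bounds the density of primes
in short intervals by 2, and if (x, λx] contains no prime power then for
almost all [n], weighted by Λ(n)/n, the interval (x/n, λx/n] attains this density.
Playing this back and forth between a window of positions [n] and the mirror
window of positions x/n, one prime power forces all of the window to have density
2, against Mertens' theorem. *)
Require Import Defs.
From HB Require Import structures.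
From mathcomp Require Import all_boot all_order all_algebra all_field.
From mathcomp Require boolp.
From mathcomp Require Import ring lra zify.

Set Implicit Arguments.
Unset Strict Implicit.
Unset Printing Implicit Defensive.

(** * K_{3,3}-free bipartite graphs and the upper bound *)

(** The difference of the two sides is (a - b)^2 (a + 2b). It compares the cube with its tangent at
    b and supplies the convexity. *)
Lemma cubic_AMGM (a b : nat) : 3 * a * b ^ 2 <= a ^ 3 + 2 * b ^ 3.
Proof.
case: (leqP a b) => [/subnKC|/ltnW/subnKC] <-; move: (_ - _) => t; nia.
Qed.

Lemma sum_square_le (T : finType) (x : T -> nat) :
  (\sum_a x a) ^ 2 <= #|T| * \sum_a x a ^ 2.
Proof.
rewrite -(@leq_pmul2l 2) // mulnA -mulnn big_distrlr /= big_distrr /=.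
rewrite (eq_bigr (fun a => \sum_b 2 * (x a * x b))); last first.
  by move=> a _; rewrite big_distrr.
apply: (@leq_trans (\sum_a \sum_b (x a ^ 2 + x b ^ 2))).
  by apply: leq_sum => a _; apply: leq_sum => b _; apply: nat_Cauchy.
under eq_bigr do rewrite big_split /= sum_nat_const.
by rewrite big_split /= sum_nat_const -big_distrr /= -mulnA mul2n addnn.
Qed.

Section Zarankiewicz.
Variables (A W : finType) (E : A -> W -> bool).
Hypothesis noK33 : forall (S : {set A}) (U : {set W}), #|S| = 3 -> #|U| = 3 ->
  ~ {in S & U, forall a w, E a w}.

Let nb w := [set a | E a w].
Let deg a := #|[set w | E a w]|.

(** Counts triples inside [nb w]: each lies in [nb w'] for at most one [w'] other than [w], since
    two would complete a K_{3,3}. Binomials become cubes through (k - 2)^3 <= k(k - 1)(k - 2) <=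
    k^3, with truncated subtraction. *)
Lemma common_neighbours_bound w :
  \sum_(w' | w' != w) (#|nb w :&: nb w'| - 2) ^ 3 <= #|nb w| ^ 3.
Proof.
have bin3 k : (k - 2) ^ 3 <= 6 * 'C(k, 3) <= k ^ 3.
  have -> : 6 * 'C(k, 3) = k * (k.-1 * k.-2).
    by rewrite mulnC -[6]/(3`!) bin_ffact !ffactnS ffactn0 muln1.
  case: k => [|[|k]] //=; rewrite ?subSS ?subn0; apply/andP; split; nia.
apply: (@leq_trans (\sum_(w' | w' != w) 6 * 'C(#|nb w :&: nb w'|, 3))).
  by apply: leq_sum => w' _; case/andP: (bin3 #|nb w :&: nb w'|).
apply: (@leq_trans (6 * 'C(#|nb w|, 3))); last by case/andP: (bin3 #|nb w|).
rewrite -big_distrr leq_mul2l /= -cards_draws -sum1dep_card.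
under eq_bigr do rewrite -cards_draws -sum1dep_card.
rewrite (exchange_big_dep (fun T : {set A} => (T \subset nb w) && (#|T| == 3))) /=;
  last by move=> w' T _ /andP[]; rewrite subsetI => /andP[-> _] ->.
apply: leq_sum => T /andP[Tw /eqP T3]; rewrite sum1dep_card leqNgt; apply/negP.
move=> /card_gt1P[u [v []]]; rewrite !inE T3 eqxx !andbT !subsetI Tw /=.
move=> /andP[uw /= Tu] /andP[vw /= Tv] uv.
have [] := @noK33 T [set w; u; v] T3.
  by rewrite -setUA cardsU1 !inE cards2 uv eq_sym (negPf uw) eq_sym (negPf vw).
move=> a z aT; rewrite !inE => /orP[/orP[]|] /eqP ->.
- by move/subsetP: Tw => /(_ _ aT); rewrite inE.
- by move: Tu => /subsetP/(_ _ aT); rewrite inE.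
- by move: Tv => /subsetP/(_ _ aT); rewrite inE.
Qed.

(** At density 1/m a codegree of [w] should be near d/m, where d = #|nb w|. The cubes are linearised
    there, by [cubic_AMGM] at m(I - 2) and d; summing and cancelling d^2 gives the main term. The
    remaining terms pay for w' = w and for the shift by 2. *)
Lemma codegree_sum_bound (m : nat) w :
  3 * m * \sum_w' #|nb w :&: nb w'|
  <= #|nb w| * (m ^ 3 + 2 * #|W| + 3 * m) + 6 * m * #|W|.
Proof.
set d := #|nb w|; set I := fun w' => #|nb w :&: nb w'|.
have H0 : 3 * m * \sum_(w' | w' != w) (I w' - 2) <= d * (m ^ 3 + 2 * #|W|).
  have [d0|d0] := posnP d.
    rewrite big1 ?muln0 // => w' _; apply/eqP; rewrite subn_eq0 /I.
    by rewrite (leq_trans (subset_leq_card (subsetIl _ _))) // -/d d0.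
  rewrite -(@leq_pmul2l (d ^ 2)) ?expn_gt0 ?d0 // mulnA big_distrr /=.
  apply: (@leq_trans (\sum_(w' | w' != w) (m ^ 3 * (I w' - 2) ^ 3 + 2 * d ^ 3))).
    apply: leq_sum => w' _; have := cubic_AMGM (m * (I w' - 2)) d.
    by rewrite expnMn; nia.
  rewrite big_split /= -big_distrr sum_nat_cond_const.
  have := common_neighbours_bound w; rewrite -/d -/I.
  set s := \sum_(_ | _) _; have : #|[set w' | w' != w]| <= #|W| by apply: max_card.
  have -> : d ^ 2 * (d * (m ^ 3 + 2 * #|W|)) = m ^ 3 * d ^ 3 + #|W| * (2 * d ^ 3).
    by rewrite mulnA -expnSr mulnDr; congr (_ + _); rewrite mulnC // mulnAC mulnC.
  move=> cW sd; apply: leq_add; first by rewrite leq_mul2l sd orbT.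
  by rewrite leq_mul2r cW orbT.
have H1 : \sum_w' I w' <= d + \sum_(w' | w' != w) (I w' - 2) + 2 * #|W|.
  rewrite (bigD1 w) //= /I setIid -/d -addnA leq_add2l -/I.
  apply: (@leq_trans (\sum_(w' | w' != w) ((I w' - 2) + 2))).
    by apply: leq_sum => w' _; rewrite addnC -leq_subLR.
  rewrite big_split /= leq_add2l sum_nat_cond_const mulnC leq_mul2l /=.
  exact: max_card.
move: H0 H1; rewrite -/I; move: (\sum_(_ | _) _) (\sum_ _ _) #|W| => s t N; nia.
Qed.

(** The sum of deg^2 equals the sum of all codegrees, bounded above by [codegree_sum_bound].
    Cauchy-Schwarz bounds it below by e^2 / |A|, and one factor e is then cancelled. *)
Lemma zarankiewicz_K33 (m : nat) : 0 < #|A| -> 0 < #|W| -> 0 < m ->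
  #|A| * #|W| <= m * \sum_a deg a ->
  3 * (#|A| * #|W|) <= #|A| * (m ^ 3 + 2 * #|W| + 3 * m) + 6 * m ^ 2 * #|W|.
Proof.
move=> A0 W0 m0; set e := \sum_a deg a => He.
have eE : e = \sum_w #|nb w|.
  rewrite /e /deg; under eq_bigr do rewrite -sum1dep_card big_mkcond.
  rewrite exchange_big; apply: eq_bigr => w _.
  by rewrite -sum1dep_card -big_mkcond.
have degE : \sum_a deg a ^ 2 = \sum_w \sum_w' #|nb w :&: nb w'|.
  transitivity (\sum_a \sum_w \sum_w' (E a w && E a w' : nat)).
    apply: eq_bigr => a _; rewrite -mulnn {1}/deg -sum1dep_card big_mkcond.
    rewrite big_distrl; apply: eq_bigr => w _ /=; rewrite /deg -sum1dep_card.
    rewrite [X in _ * X]big_mkcond big_distrr; apply: eq_bigr => w' _ /=.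
    by case: (E a w); case: (E a w').
  rewrite exchange_big; apply: eq_bigr => w _; rewrite exchange_big.
  apply: eq_bigr => w' _; rewrite -sum1_card [RHS]big_mkcond.
  by apply: eq_bigr => a _; rewrite !inE; case: (_ && _).
have H : 3 * m * \sum_a deg a ^ 2 <=
    e * (m ^ 3 + 2 * #|W| + 3 * m) + 6 * m * #|W| * #|W|.
  rewrite degE big_distrr /= eE big_distrl /= [X in _ + X]mulnC -sum_nat_const.
  by rewrite -big_split; apply: leq_sum => w _; apply: codegree_sum_bound.
have C := sum_square_le deg; rewrite -/e in C.
have e0 : 0 < e by move: He; case: (e) => //; rewrite muln0; nia.
rewrite -(@leq_pmul2l e) //; move: C H He; move: (\sum_a _) => s.
set n := #|A|; set N := #|W|; set K := m ^ 3 + 2 * N + 3 * m => C H He.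
have H1 : 3 * m * (e ^ 2) <= n * (e * K + 6 * m * N * N).
  apply: leq_trans (_ : n * (3 * m * s) <= _); first by nia.
  by rewrite leq_mul2l H orbT.
(* The density hypothesis |A| |W| <= m e turns the error term into a multiple of e, ready for the
   cancellation. *)
have H2 : n * (6 * m * N * N) <= 6 * m ^ 2 * N * e.
  have -> : n * (6 * m * N * N) = 6 * m * N * (n * N) by nia.
  have -> : 6 * m ^ 2 * N * e = 6 * m * N * (m * e) by nia.
  by rewrite leq_mul2l He orbT.
have H3 : e * (3 * (n * N)) <= e * (3 * (m * e)) by rewrite !leq_mul2l He !orbT.
apply: leq_trans H3 _; nia.
Qed.

End Zarankiewicz.

(** * Edge colourings read on pairs of vertices, and the upper bound *)

Section EdgeColor.
Variables (G : sgraph) (m : nat) (c : edge G -> 'I_m).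

(** Avoids the subtype of edges: [None] marks a pair that is not an edge. *)
Definition edge_color (u v : vertex G) : option 'I_m :=
  omap c (insub [set u; v]).

Lemma mem_edges (u v : vertex G) : adj u v -> [set u; v] \in edges G.
Proof. by move=> uv; apply/imsetP; exists (u, v) => //; rewrite inE. Qed.

Lemma edge_colorC u v : edge_color u v = edge_color v u.
Proof. by rewrite /edge_color setUC. Qed.

Lemma edge_color_adj u v : adj u v -> exists k, edge_color u v = Some k.
Proof.
by move=> /mem_edges uv; rewrite /edge_color insubT; eexists.
Qed.

Lemma edge_colorP u v k :
  edge_color u v = Some k -> exists2 e : edge G, val e = [set u; v] & c e = k.
Proof.
rewrite /edge_color; case: insubP => //= e _ eE [<-]; by exists e.
Qed.

Lemma edge_color_val (e : edge G) u v : val e = [set u; v] -> edge_color u v = Some (c e).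
Proof. by move=> eE; rewrite /edge_color -eE valK. Qed.

Lemma mono_copyP (H : sgraph) : mono_copy H c <->
  exists f : vertex H -> vertex G, injective f /\
  exists k, forall p q, adj p q -> edge_color (f p) (f q) = Some k.
Proof.
have fset2 (f : vertex H -> vertex G) p q : f @: [set p; q] = [set f p; f q].
  by rewrite imsetU1 imset_set1.
split=> -[f [finj [k fk]]]; exists f; split=> //; exists k.
  move=> p q pq.
  have pqE : [set p; q] \in edges H.
    by apply/imsetP; exists (p, q) => //; rewrite inE.
  have [e' e'E <-] := fk (Sub [set p; q] pqE).
  by apply: edge_color_val; rewrite e'E /= fset2.
case=> e /= eH; have /imsetP[[p q]] := eH; rewrite inE /= => pq ->.
by rewrite fset2; apply: edge_colorP; apply: fk.
Qed.

End EdgeColor.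

Theorem arrows_K33 (m n : nat) : 0 < m -> m ^ 3 + 12 * m ^ 2 + 3 * m < 2 * n ->
  multipartite_arrows 3 m K33 n.
Proof.
move=> m0 mn c; have n0 : 0 < n by case: n mn {c}.
pose w0 (w : 'I_2 * 'I_n) : 'I_3 * 'I_n := (lift ord0 w.1, w.2).
pose a0 (a : 'I_n) : 'I_3 * 'I_n := (ord0, a).
pose E k a w := edge_color c (a0 a) (w0 w) == Some k.
have adj0 a w : @adj (complete_multipartite 3 n) (a0 a) (w0 w).
  exact: neq_lift.
(* Pigeonhole: the classes together have n * 2n edges, so some class reaches the average. If none
   did, each would miss it by at least 1, which is the [+ 1] below. *)
have [k Hk] : exists k : 'I_m,
    #|'I_n| * #|{: 'I_2 * 'I_n}| <= m * \sum_a #|[set w | E k a w]|.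
  apply/existsP; apply: contraT => /existsPn small.
  have tot : \sum_(k < m) \sum_a #|[set w | E k a w]| = #|'I_n| * #|{: 'I_2 * 'I_n}|.
    rewrite exchange_big /= -sum_nat_const; apply: eq_bigr => a _.
    under eq_bigr do rewrite -sum1dep_card big_mkcond.
    rewrite exchange_big /= -sum1_card; apply: eq_bigr => w _.
    have [k kE] := edge_color_adj c (adj0 a w).
    rewrite (bigD1 k) //= /E kE eqxx big1 // => l lk.
    by rewrite (inj_eq Some_inj) eq_sym (negPf lk).
  have : \sum_(k < m) (m * \sum_a #|[set w | E k a w]| + 1) <=
      \sum_(k < m) #|'I_n| * #|{: 'I_2 * 'I_n}|.
    by apply: leq_sum => k _; rewrite addn1 ltnNge.
  rewrite big_split /= -big_distrr tot !sum_nat_const !card_ord /= muln1.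
  by move: (n * _) => X; lia.
apply: boolp.contrapT => ncopy.
have noK33 (S : {set 'I_n}) (U : {set 'I_2 * 'I_n}) : #|S| = 3 -> #|U| = 3 ->
    ~ {in S & U, forall a w, E k a w}.
  move=> S3 U3 SU; apply: ncopy; apply/mono_copyP.
  pose s (j : 'I_3) := enum_val (cast_ord (esym S3) j).
  pose u (j : 'I_3) := enum_val (cast_ord (esym U3) j).
  have su i j : edge_color c (a0 (s i)) (w0 (u j)) = Some k.
    by apply/eqP; apply: SU; apply: enum_valP.
  pose f (p : 'I_2 * 'I_3) := if p.1 == ord0 then a0 (s p.2) else w0 (u p.2).
  have two (i : 'I_2) : i != ord0 -> i = ord_max by case: i => -[|[]] //= *; apply/val_inj.
  exists f; split.
    move=> [i x] [j y]; rewrite /f /=.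
    case: eqVneq => [->|/two ->]; case: eqVneq => [->|/two ->] //.
    - by case=> /enum_val_inj/cast_ord_inj ->.
    - move=> uxy; have E1 := lift_inj (congr1 fst uxy); have E2 := congr1 snd uxy.
      congr (_, _).
      by apply: (@cast_ord_inj _ _ (esym U3)); apply: enum_val_inj; apply: injective_projections.
  exists k => -[i x] [j y]; rewrite /= /multipartite_adj /f /=.
  case: (eqVneq i ord0) => [->|/two ->];
    case: (eqVneq j ord0) => [j0|/two j0]; rewrite ?j0 //= => _.
  by rewrite edge_colorC.
(* With |A| = n and |W| = 2n, division by n leaves 6n <= m^3 + 4n + 3m + 12m^2. *)
have := zarankiewicz_K33 noK33 _ _ m0 Hk.
rewrite card_prod !card_ord muln_gt0 n0 => /(_ isT isT); move: mn.
set K := m ^ 3 => mn H.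
have : n * (2 * n) <= n * (K + 12 * m ^ 2 + 3 * m) by move: H; clear; nia.
by rewrite leq_pmul2l // leqNgt mn.
Qed.

(** * Three-partite colourings *)

Definition next_part (i j : 'I_3) : bool := (j == i.+1 %% 3 :> nat).

Lemma next_or i j : i != j -> next_part i j = ~~ next_part j i.
Proof. by move: i j => [[|[|[|//]]] hi] [[|[|[|//]]] hj]. Qed.

Lemma next_inj i j k : next_part i j -> next_part i k -> j = k.
Proof. by rewrite /next_part => /eqP ij /eqP ik; apply: val_inj; rewrite /= ij ik. Qed.

Lemma prev_inj i j k : next_part j i -> next_part k i -> j = k.
Proof.
by move: i j k => [[|[|[|//]]] hi] [[|[|[|//]]] hj] [[|[|[|//]]] hk] //= *; apply: val_inj.
Qed.

(** The two sides of a K_{3,3} occupy disjoint nonempty sets of parts, and of two such subsets of a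
    3-element set one is a singleton. So every copy has a side inside one part. *)
Lemma separated_parts (s t : 'I_3 -> 'I_3) : (forall x y, s x != t y) ->
  (exists i, forall x, s x = i) \/ (exists i, forall x, t x = i).
Proof.
move=> st.
have [/forallP H|/forallPn[x sx]] := boolP [forall x, s x == s ord0].
  by left; exists (s ord0) => x; apply/eqP.
right; exists (t ord0) => y.
have := st x y; have := st x ord0; have := st ord0 y; have := st ord0 ord0; move: sx.
move: (s x) (s ord0) (t y) (t ord0).
by move=> [[|[|[|//]]] ?] [[|[|[|//]]] ?] [[|[|[|//]]] ?] [[|[|[|//]]] ?] //= *; apply: val_inj.
Qed.

Section Coloring.
Variables (m n : nat) (T : finType) (CS : {set T}).
Variable kappa : 'I_3 * 'I_n -> 'I_3 * 'I_n -> T.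
Hypothesis cardCS : #|CS| <= m.
Hypothesis kappa_in : forall u v, next_part u.1 v.1 -> kappa u v \in CS.

Definition sym_color (u v : 'I_3 * 'I_n) : T := if next_part u.1 v.1 then kappa u v else kappa v u.

Lemma sym_colorC u v : u.1 != v.1 -> sym_color u v = sym_color v u.
Proof. by move=> /next_or; rewrite /sym_color => ->; case: (next_part v.1 u.1). Qed.

Lemma sym_color_in u v : u.1 != v.1 -> sym_color u v \in CS.
Proof.
by move=> /next_or; rewrite /sym_color; case: ifP => [/kappa_in //|_ /esym/negbFE/kappa_in].
Qed.

Hypothesis m0 : 0 < m.
Hypothesis no_star : forall (i : 'I_3) (g : 'I_3 -> 'I_n) (h : 'I_3 -> 'I_3 * 'I_n) t,
  injective g -> injective h -> (forall y, (h y).1 != i) ->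
  (forall x y, sym_color (i, g x) (h y) = t) -> False.

(** By [separated_parts] every copy has, up to swapping its sides, the shape excluded by
    [no_star]. *)
Lemma coloring_not_arrows : ~ multipartite_arrows 3 m K33 n.
Proof.
pose G := complete_multipartite 3 n.
have m1 : m.-1.+1 = m by rewrite prednK.
pose code (t : T) : 'I_m := cast_ord m1 (inord (index t (enum CS))).
have code_inj : {in CS &, injective code}.
  move=> s t sC tC /cast_ord_inj /(congr1 val) /=.
  have lt r : r \in CS -> index r (enum CS) < m.-1.+1.
    by move=> rC; rewrite m1 (leq_trans _ cardCS) // cardE index_mem mem_enum.
  rewrite !inordK ?lt // => E.
  by rewrite -[s](nth_index s (_ : s \in enum CS)) ?mem_enum // E nth_index ?mem_enum.
(* An arbitrary ordering of the two ends; [sym_colorC] makes the choice harmless. Every edge has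
   ends, so the default colour in [c] never occurs. *)
pose endpoints (ed : edge G) : option (vertex G * vertex G) :=
  [pick uv : vertex G * vertex G | adj uv.1 uv.2 && (val ed == [set uv.1; uv.2])].
pose c (ed : edge G) : 'I_m :=
  if endpoints ed is Some uv then code (sym_color uv.1 uv.2) else cast_ord m1 ord0.
have cE (u v : vertex G) k : edge_color c u v = Some k ->
    u.1 != v.1 /\ code (sym_color u v) = k.
  move=> /edge_colorP[ed edE <-].
  have uv1 : u.1 != v.1.
    have := valP ed; rewrite edE => /imsetP[[a b]]; rewrite inE /= => ab E.
    apply: contraTneq ab => uv; rewrite negbK.
    have /set2P[] : a \in [set u; v] by rewrite E set21.
      by move=> ->; have /set2P[->|->] : b \in [set u; v]; rewrite ?E ?set22 ?uv.
    by move=> ->; have /set2P[->|->] : b \in [set u; v]; rewrite ?E ?set22 ?uv.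
  split=> //; rewrite /c /endpoints; case: pickP => [[a b] /= /andP[ab]|/(_ (u, v))]; last first.
    by rewrite /= edE eqxx andbT /multipartite_adj uv1.
  rewrite edE => /eqP E; have ab' : a != b by apply: contraNneq ab => ->.
  have : a \in [set u; v] by rewrite E set21.
  have : b \in [set u; v] by rewrite E set22.
  move=> /set2P[] bE /set2P[] aE; move: ab'; rewrite aE bE ?eqxx //= => _.
  by rewrite sym_colorC // eq_sym.
move=> /(_ c) /mono_copyP[f [finj [k fk]]].
have /(_ _ _) fk' x y := cE _ _ _ (fk (ord0, x) (ord_max, y) isT).
pose t := sym_color (f (ord0, ord0)) (f (ord_max, ord0)).
have ft x y : sym_color (f (ord0, x)) (f (ord_max, y)) = t.
  have [d1 c1] := fk' x y; have [d2 c2] := fk' ord0 ord0.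
  by apply: code_inj; rewrite ?sym_color_in // c1 c2.
have inj1 i : injective (fun x : 'I_3 => f (i, x)).
  by move=> x y /finj [].
have [[i Hi]|[i Hi]] := separated_parts (fun x y => proj1 (fk' x y)).
  apply: (@no_star i (fun x => (f (ord0, x)).2) (fun y => f (ord_max, y)) t) => //.
  - by move=> x y xy; apply: (inj1 ord0); apply: injective_projections; rewrite //= !Hi.
  - by move=> y; rewrite -(Hi ord0) eq_sym; case: (fk' ord0 y).
  - by move=> x y; rewrite -(ft x y) -(Hi x) -surjective_pairing.
apply: (@no_star i (fun x => (f (ord_max, x)).2) (fun y => f (ord0, y)) t) => //.
- by move=> x y xy; apply: (inj1 ord_max); apply: injective_projections; rewrite //= !Hi.
- by move=> y; rewrite -(Hi ord0); case: (fk' y ord0).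
- move=> x y; rewrite -(ft y x) -(Hi x) -surjective_pairing sym_colorC //.
  by rewrite eq_sym; case: (fk' y x).
Qed.

End Coloring.

(* A line-point incidence over the integers: writing [a = a1 s + a0] and
   [b = b1 s + b0], the value is [k] iff [(b0, b1)] lies on the line
   [b1 = k - a1 - a0 b0], and two such lines meet at most once. *)
Definition digit_color (s a b : nat) : nat := a %/ s + (a %% s) * (b %% s) + b %/ s.

(** For fixed s this is 2t/s + O(1), so a large s makes these colours an arbitrarily small fraction
    of t. *)
Lemma digit_color_bound s t a b : 0 < s -> a < t -> b < t ->
  digit_color s a b < 2 * (t %/ s) + s ^ 2.
Proof.
move=> s0 ta tb; rewrite /digit_color.
have A := leq_div2r s (ltnW ta); have B := leq_div2r s (ltnW tb).
have C := ltn_pmod a s0; have D := ltn_pmod b s0.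
move: A B C D; move: (a %/ s) (b %/ s) (t %/ s) (a %% s) (b %% s) => *; nia.
Qed.

Lemma digit_color_K22 s a a' b b' : a != a' -> b != b' ->
  digit_color s a b = digit_color s a b' -> digit_color s a' b = digit_color s a' b' ->
  digit_color s a b = digit_color s a' b -> False.
Proof.
rewrite /digit_color => aa bb.
have := divn_eq a s; have := divn_eq a' s; have := divn_eq b s; have := divn_eq b' s.
move: (a %/ s) (a' %/ s) (b %/ s) (b' %/ s) (a %% s) (a' %% s) (b %% s) (b' %% s).
move=> A A' B B' u u' v v' eb' eb ea' ea e1 e2 e3.
(* (u - u') (v - v') = 0 *)
have uu : u = u' \/ v = v' by nia.
case: uu => E; subst.
  have AA : A = A' by nia.
  by rewrite AA eqxx in aa.
have BB : B = B' by nia.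
by rewrite BB eqxx in bb.
Qed.

(** * Projective norm graphs *)

Import GRing.Theory.

Section FiniteFields.
Local Open Scope ring_scope.

Lemma quadratic_three_roots (F : fieldType) (a b c y1 y2 y3 : F) :
  a != 0 -> y1 != y2 -> y1 != y3 -> y2 != y3 ->
  a * y1 ^+ 2 + b * y1 + c = 0 -> a * y2 ^+ 2 + b * y2 + c = 0 ->
  a * y3 ^+ 2 + b * y3 + c = 0 -> False.
Proof.
move=> a0 y12 y13 y23 e1 e2 e3.
have H y : y1 != y -> a * y ^+ 2 + b * y + c = 0 -> a * (y1 + y) + b = 0.
  move=> yy e; have : (y1 - y) * (a * (y1 + y) + b) = 0.
    have -> : (y1 - y) * (a * (y1 + y) + b) =
       (a * y1 ^+ 2 + b * y1 + c) - (a * y ^+ 2 + b * y + c) by ring.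
    by rewrite e1 e subrr.
  by move/eqP; rewrite mulf_eq0 subr_eq0 (negPf yy) => /eqP.
have : a * (y2 - y3) = 0.
  have -> : a * (y2 - y3) = (a * (y1 + y2) + b) - (a * (y1 + y3) + b) by ring.
  by rewrite !H // subrr.
by move/eqP; rewrite mulf_eq0 subr_eq0 (negPf a0) (negPf y23).
Qed.

Lemma card_power_eq (F : finFieldType) (n : nat) (a : F) : (0 < n)%N ->
  (#|[set x : F | x ^+ n == a]| <= n)%N.
Proof.
move=> n0; rewrite cardE -ltnS -(size_XnsubC a n0).
apply: max_poly_roots; rewrite ?enum_uniq //.
  by rewrite -size_poly_eq0 size_XnsubC.
apply/allP => x; rewrite mem_enum inE => /eqP xa.
by rewrite /root !hornerE xa subrr.
Qed.

Section QuadraticExtension.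
Variables (L : finFieldType) (p e : nat).
Hypotheses (pchar : p \in [pchar L]) (oddp : odd p) (e0 : (0 < e)%N).
Implicit Types x y z : L.
Let q := (p ^ e)%N.
Hypothesis cardL : #|L| = (q ^ 2)%N.

Let q3 : (3 <= q)%N.
Proof.
have /andP[pp _] := pchar; rewrite /q.
have p3 : (3 <= p)%N by case: p pp oddp => [|[|[|]]].
by rewrite (leq_trans p3) // -{1}[p]expn1 leq_exp2l // (leq_trans _ p3).
Qed.

Let oddq : odd q. Proof. by rewrite /q oddX oddp orbT. Qed.

(** The norm of GF(q^2) over GF(q), kept as a map from L to itself; GF(q) appears only through its
    units, as fixed points of x -> x^q. *)
Definition qnorm (x : L) : L := x * x ^+ q.

Lemma frobD x y : (x + y) ^+ q = x ^+ q + y ^+ q.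
Proof.
rewrite exprDn_pchar // (eq_pnat _ (pcharf_eq pchar)) pnatX.
by rewrite pnat_id ?(pcharf_prime pchar).
Qed.

Lemma frobN x : (- x) ^+ q = - x ^+ q.
Proof. by rewrite exprNn -signr_odd oddq mulN1r. Qed.

Lemma frobK x : (x ^+ q) ^+ q = x.
Proof. by rewrite -exprM -[RHS]expf_card cardL mulnn. Qed.

Lemma qnormM x y : qnorm (x * y) = qnorm x * qnorm y.
Proof. by rewrite /qnorm exprMn; ring. Qed.

Lemma qnormV x : qnorm x^-1 = (qnorm x)^-1.
Proof. by rewrite /qnorm exprVn invfM. Qed.

Lemma qnorm_eq0 x : (qnorm x == 0) = (x == 0).
Proof. by rewrite /qnorm mulf_eq0 expf_eq0 andbC; case: (x == 0) => //=; rewrite andbF. Qed.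

Lemma qnorm_frob x : qnorm x ^+ q = qnorm x.
Proof. by rewrite /qnorm exprMn frobK mulrC. Qed.

Definition subfield_units : {set L} := [set x | (x != 0) && (x ^+ q == x)].
Local Notation K := subfield_units.

Lemma qnorm_in x : x != 0 -> qnorm x \in K.
Proof. by move=> x0; rewrite inE qnorm_eq0 x0 qnorm_frob eqxx. Qed.

Lemma subfield_units_div x y z : x \in K -> y \in K -> z \in K -> x / (y * z) \in K.
Proof.
rewrite !inE => /andP[x0 /eqP xq] /andP[y0 /eqP yq] /andP[z0 /eqP zq].
by rewrite mulf_neq0 ?invr_eq0 ?mulf_neq0 //= expr_div_n exprMn xq yq zq.
Qed.

Lemma card_units : #|[set x : L | x != 0]| = (q ^ 2 - 1)%N.
Proof.
rewrite -cardL (_ : [set x : L | x != 0] = ~: [set 0]); last by apply/setP => x; rewrite !inE.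
by rewrite cardsC1 subn1.
Qed.

(** Upper bound: the elements are roots of x^(q-1) = 1. Lower bound: the norm sends the q^2 - 1
    units into [K] with fibres of size at most q + 1. *)
Lemma card_subfield_units : #|K| = q.-1.
Proof.
apply/eqP; rewrite eqn_leq; apply/andP; split.
  have q10 : (0 < q.-1)%N by case: (q) q3 => [|[]].
  apply: leq_trans (card_power_eq 1 q10); apply: subset_leq_card.
  apply/subsetP => x; rewrite !inE => /andP[x0 /eqP xq]; apply/eqP.
  by apply: (mulfI x0); rewrite -exprS prednK ?xq ?mulr1 // (leq_trans _ q3).
have : (#|[set x : L | x != 0%R]| <= #|K| * q.+1)%N.
  rewrite -sum1_card (partition_big qnorm (mem K)) /=; last first.
    by move=> x; rewrite inE => /qnorm_in.
  rewrite -sum_nat_const; apply: leq_sum => k _.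
  apply: leq_trans (card_power_eq k (ltn0Sn q)).
  rewrite sum1dep_card; apply: subset_leq_card; apply/subsetP => x.
  by rewrite !inE => /andP[_]; rewrite exprS.
rewrite card_units; have -> : (q ^ 2 - 1 = q.-1 * q.+1)%N by case: (q) => // k; nia.
by rewrite leq_pmul2r.
Qed.

(** As q is odd, q^2 - 1 = 4h. Not all 4h units are roots of x^(2h) = 1; for a unit z that is not,
    z^(2h) = -1, and z^h is the root sought. *)
Lemma exists_sqrtN1 : exists i : L, i * i = -1.
Proof.
have [h hE] : exists h, (q ^ 2 - 1 = 4 * h)%N.
  exists (q./2 * (q./2 + 1))%N; have := odd_double_half q; rewrite oddq.
  by move: q./2 => k <-; nia.
have h0 : (0 < 2 * h)%N by move: hE; have := q3; nia.
have [z z0 zh] : exists2 z : L, z != 0 & z ^+ (2 * h) != 1.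
  apply/exists_inP; apply: contraT => /exists_inPn H.
  have : (#|[set x : L | x != 0%R]| <= 2 * h)%N.
    apply: leq_trans (card_power_eq 1 h0); apply: subset_leq_card.
    by apply/subsetP => x; rewrite !inE => /H; rewrite negbK.
  by rewrite card_units hE leq_pmul2r // ; move: h0; case: (h).
exists (z ^+ h); rewrite -exprD addnn -mul2n.
have z4 : z ^+ (2 * h) * z ^+ (2 * h) = 1.
  rewrite -exprD -mulnDl (_ : (2 + 2 = 4)%N) // -hE; apply: (mulfI z0).
  by rewrite -exprS mulr1 -[RHS]expf_card cardL subn1 prednK // expn_gt0 (leq_trans _ q3).
have : (z ^+ (2 * h) - 1) * (z ^+ (2 * h) + 1) = 0.
  by rewrite -subr_sqr expr1n expr2 z4 subrr.
move/eqP; rewrite mulf_eq0 subr_eq0 (negPf zh) /= addr_eq0 => /eqP //.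
Qed.

Lemma pnatr2_neq0 : (2 : L) != 0.
Proof.
rewrite -(dvdn_pcharf pchar); have /andP[pp _] := pchar.
by apply: contraL oddp; rewrite dvdn_prime2 // => /eqP ->.
Qed.

(* Any choice of one element from each pair [x, -x] would do. *)
Definition half_system : {set L} :=
  [set x | (x != 0) && (enum_rank x < enum_rank (- x)%R)%N].
Local Notation P := half_system.

Lemma half_systemN x : x \in P -> - x \notin P.
Proof.
by rewrite !inE opprK => /andP[_ xx]; rewrite negb_and -leqNgt ltnW ?orbT.
Qed.

(** The units outside [P] are exactly -P, because x = -x would force 2x = 0 in odd
    characteristic. *)
Lemma card_half_system : (2 * #|P| = q ^ 2 - 1)%N.
Proof.
rewrite -card_units -(cardsID P [set x | x != 0]) mul2n -addnn; congr (_ + _)%N.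
  by apply: eq_card => x; rewrite !inE; case: (x != 0).
rewrite -(card_imset _ oppr_inj); apply: eq_card => x; apply/imsetP/idP.
  move=> [y yP ->]; rewrite !inE oppr_eq0; move: (half_systemN yP) (yP).
  by rewrite !inE oppr_eq0 => -> /andP[->].
rewrite !inE => /andP[xP x0]; exists (- x); rewrite ?opprK // inE oppr_eq0 x0 opprK.
rewrite x0 -leqNgt leq_eqVlt in xP; have /orP[/eqP xx|//] := xP.
have /eqP := enum_rank_inj (val_inj xx); rewrite eq_sym -addr_eq0 -mulr2n.
by rewrite -mulr_natl mulf_eq0 (negPf pnatr2_neq0) (negPf x0).
Qed.

(** Dividing two of the equations by the third and inverting the variable leaves two norm equations
    in one unknown Y. They reduce to a quadratic equation, which cannot have the three distinct
    roots coming from [g]. *)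
Lemma projective_norm_K33 (c : L) (f g : 'I_3 -> L * L) : c != 0 ->
  injective f -> injective g ->
  (forall j, (f j).2 != 0) -> (forall l, (g l).2 != 0) ->
  (forall j l, qnorm ((f j).1 + (g l).1) = c * (f j).2 * (g l).2) -> False.
Proof.
move=> c0 finj ginj f0 g0 H.
have f1inj j j' : j != j' -> (f j).1 != (f j').1.
  apply: contra => /eqP E; apply/eqP; apply: finj; apply: injective_projections => //.
  have := H j ord0; rewrite E H => /(mulIf (g0 _)) /(mulfI c0) //.
have g1inj j j' : j != j' -> (g j).1 != (g j').1.
  apply: contra => /eqP E; apply/eqP; apply: ginj; apply: injective_projections => //.
  have := H ord0 j; rewrite E H => /mulfI -> //; by rewrite mulf_neq0.
have s0 j l : (f j).1 + (g l).1 != 0 by rewrite -qnorm_eq0 H !mulf_neq0.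
pose A j := (f j).1; pose X l := (g l).1; pose a j := (f j).2.
pose i0 : 'I_3 := ord0; pose i1 : 'I_3 := inord 1; pose i2 : 'I_3 := inord 2.
have i01 : i0 != i1 by rewrite -val_eqE /= inordK.
have i02 : i0 != i2 by rewrite -val_eqE /= inordK.
have i12 : i1 != i2 by rewrite -val_eqE /= !inordK.
(* The quotient (A j + X) / (A i2 + X), divided by A j - A i2, is Y + B j. *)
pose Y l := (A i2 + X l)^-1.
pose B j := (A j - A i2)^-1; pose b j := a j / (a i2 * qnorm (A j - A i2)).
have d0 j : j != i2 -> A j - A i2 != 0 by move=> ji; rewrite subr_eq0 f1inj.
have HB j l : j != i2 -> qnorm (Y l + B j) = b j.
  move=> ji; have -> : Y l + B j = (A j + X l) * (Y l * B j).
    by rewrite /Y /B; field; rewrite d0 // s0.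
  rewrite !qnormM !qnormV H H /b /a; field.
  by rewrite c0 !f0 g0 qnorm_eq0 d0.
have Yinj l l' : l != l' -> Y l != Y l'.
  by move=> ll; rewrite (inj_eq invr_inj) (inj_eq (addrI _)) g1inj.
pose D := B i0 - B i1; pose E := B i0 ^+ q - B i1 ^+ q.
have D0 : D != 0.
  by rewrite subr_eq0 (inj_eq invr_inj) (inj_eq (addIr _)) f1inj.
have E0 : E != 0.
  by rewrite /E -frobN -frobD expf_neq0.
pose k := B i0 * B i0 ^+ q - b i0 - (B i1 * B i1 ^+ q - b i1).
(* Subtracting the two expanded norm equations removes the product of Y and Y^q, so Y^q becomes an
   affine function of Y. *)
have Z l : Y l ^+ q = - (E * Y l + k) / D.
  have := HB i0 l i02; have := HB i1 l i12; rewrite /qnorm !frobD => e1 e2.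
  apply: (mulIf D0); rewrite divfK //.
  rewrite /k /D /E -e1 -e2; ring.
pose al := - (E / D); pose be := - k / D.
(* Substituting this into the equation for [i0] gives the quadratic; its leading coefficient -E/D is
   nonzero. *)
have Q l : al * Y l ^+ 2 + (be + B i0 ^+ q + B i0 * al) * Y l
    + (B i0 * be + B i0 * B i0 ^+ q - b i0) = 0.
  have := HB i0 l i02; rewrite /qnorm !frobD Z => <-.
  by rewrite /al /be; field.
apply: (quadratic_three_roots _ (Yinj _ _ i01) (Yinj _ _ i02) (Yinj _ _ i12)
   (Q i0) (Q i1) (Q i2)).
by rewrite oppr_eq0 mulf_neq0 ?invr_eq0.
Qed.

End QuadraticExtension.

End FiniteFields.

(** * The norm colouring of the complete tripartite graph *)

Section NormColoring.
Variables (L : finFieldType) (p e : nat).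
Hypotheses (pchar : p \in [pchar L]%R) (oddp : odd p) (e0 : 0 < e).
Let q := p ^ e.
Hypothesis cardL : #|L| = q ^ 2.
Variable I : L.
Hypothesis I2 : (I * I = -1)%R.
Variables (s m n : nat).
Let z := 2 * (q.-1 %/ s) + s ^ 2.
Hypothesis s0 : 0 < s.
Hypothesis Hm : q.-1 + 3 * z.+1 <= m.
Hypothesis Hn : 2 * n <= (q ^ 2 - 1) * q.-1.

Let P := half_system L.
Let K := subfield_units L p e.

Let vertex_set := finset.setX P K.

Let card_vertex_set : n <= #|vertex_set|.
Proof.
rewrite cardsX card_subfield_units //.
by rewrite -(leq_pmul2l (isT : 0 < 2)) mulnA (card_half_system pchar oddp cardL).
Qed.

Let point (a : 'I_n) : L * L := enum_val (widen_ord card_vertex_set a).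

Let point_inj : injective point.
Proof.
by move=> a b /enum_val_inj /(congr1 val) /= ab; apply: val_inj.
Qed.

Let pointP a : (point a).1 \in P /\ (point a).2 \in K.
Proof. by have := enum_valP (widen_ord card_vertex_set a); rewrite inE => /andP. Qed.

Let point2_neq0 a : ((point a).2 != 0)%R.
Proof. by have [_] := pointP a; rewrite inE => /andP[]. Qed.

Let I0 : (I != 0)%R.
Proof.
by apply/eqP => I0; move: I2; rewrite I0 mul0r => /esym/eqP; rewrite oppr_eq0 oner_eq0.
Qed.

Let digit a := index (point a).2 (enum K).

Let digit_lt a : digit a < q.-1.
Proof.
by rewrite -(card_subfield_units pchar oddp e0 cardL) cardE index_mem mem_enum; case: (pointP a).
Qed.

(** Here [u] is the tail of an edge to the next part. Degenerate edges take the digit colour tagged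
    with the part of the tail, so the three pairs of parts use disjoint digit palettes. *)
Let norm_color (u v : 'I_3 * 'I_n) : L + 'I_3 * 'I_z.+1 :=
  let x := point u.2 in let y := point v.2 in
  (if x.1 - I * y.1 == 0 then inr (u.1, inord (digit_color s (digit u.2) (digit v.2)))
   else inl (qnorm p e (x.1 - I * y.1) / (x.2 * y.2)))%R.

Let colors : {set L + 'I_3 * 'I_z.+1} :=
  [set inl k | k in K] :|: [set inr k | k in [set: 'I_3 * 'I_z.+1]].

Let card_colors : #|colors| <= m.
Proof.
apply: leq_trans Hm; apply: leq_trans (leq_card_setU _ _) _.
rewrite !card_imset; try by move=> ? ? [].
by rewrite card_subfield_units // cardsT card_prod !card_ord.
Qed.

Let norm_color_in u v : norm_color u v \in colors.
Proof.
rewrite /norm_color; case: ifP => [_|/negbT uv].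
  by rewrite inE; apply/orP; right; apply: imset_f; rewrite inE.
rewrite inE; apply/orP; left; apply: imset_f.
have [_ x2] := pointP u.2; have [_ y2] := pointP v.2.
by apply: subfield_units_div => //; apply: qnorm_in.
Qed.

Lemma norm_color_inl u v c : norm_color u v = inl c ->
  c != 0%R /\ (qnorm p e ((point u.2).1 - I * (point v.2).1) =
    c * (point u.2).2 * (point v.2).2)%R.
Proof.
rewrite /norm_color; case: ifP => // /negbT uv [<-]; split.
  by rewrite mulf_neq0 ?invr_eq0 ?qnorm_eq0 // mulf_neq0 ?point2_neq0.
by rewrite -mulrA divfK // mulf_neq0.
Qed.

Lemma norm_color_inr u v j k : norm_color u v = inr (j, k) ->
  [/\ u.1 = j, ((point u.2).1 = I * (point v.2).1)%R &
   digit_color s (digit u.2) (digit v.2) = k].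
Proof.
rewrite /norm_color; case: ifP => // /eqP /subr0_eq uv [<- <-]; split=> //.
by rewrite inordK // ltnS ltnW // digit_color_bound.
Qed.

Lemma digit_neq a b : (point a).1 = (point b).1 -> a != b -> digit a != digit b.
Proof.
move=> ab; apply: contra => /eqP dd; apply/eqP/point_inj/injective_projections => //.
have inK c : (point c).2 \in enum K by rewrite mem_enum; case: (pointP c).
by rewrite -[LHS](nth_index 0%R (inK a)) -/(digit a) dd nth_index.
Qed.

(** A norm colour would put a K_{3,3} into one projective norm graph; a digit colour would give a
    K_{2,2} between two parts. *)
Lemma norm_coloring_no_star (i : 'I_3) (g : 'I_3 -> 'I_n) (h : 'I_3 -> 'I_3 * 'I_n) t :
  injective g -> injective h -> (forall y, (h y).1 != i) ->
  (forall x y, sym_color norm_color (i, g x) (h y) = t) -> False.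
Proof.
move=> ginj hinj hi H.
have prev y : ~~ next_part i (h y).1 -> next_part (h y).1 i.
  by move=> N; rewrite next_or // N.
case: t H => [c|[j k]] H.
  have c0 : c != 0%R.
    move: (H ord0 ord0); rewrite /sym_color.
    by case: ifP => _ /norm_color_inl[].
  (* The neighbours in both other parts become points of a single norm graph. The two kinds of point
     are kept apart by [noneg]: -I v = I w would give w = -v with both in [P]. *)
  pose phi y : L * L := (if next_part i (h y).1 then (- I * (point (h y).2).1, (point (h y).2).2)
    else (I * (point (h y).2).1, (point (h y).2).2 / qnorm p e (- I)))%R.
  have nI0 : (qnorm p e (- I) != 0)%R by rewrite qnorm_eq0 // oppr_eq0.
  have noneg a b : (point a).1 = (- (point b).1)%R -> False.
    move=> ab; have [aP _] := pointP a; have [bP _] := pointP b.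
    by move/half_systemN: bP; rewrite -ab aP.
  apply: (@projective_norm_K33 _ _ e pchar oddp c (fun x => point (g x)) phi) => //.
  - by move=> x y /point_inj/ginj.
  - move=> y y'; rewrite /phi; case: ifP => ny; case: ifP => ny' [].
    + move=> /mulfI E1 E2; apply: hinj; apply: injective_projections.
        exact: next_inj ny ny'.
      by apply/point_inj/injective_projections => //; apply: E1; rewrite oppr_eq0.
    + rewrite mulNr -mulrN => /(mulfI I0) /esym E; by case: (noneg _ _ E).
    + rewrite mulNr -mulrN => /(mulfI I0) E; by case: (noneg _ _ E).
    + move=> /(mulfI I0) E1 /mulIf E2; apply: hinj; apply: injective_projections.
        by apply: (@prev_inj i); apply: prev; rewrite ?ny ?ny'.
      by apply/point_inj/injective_projections => //; apply: E2; rewrite invr_eq0.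
  - by move=> y; rewrite /phi; case: ifP => _ /=; rewrite ?mulf_neq0 ?invr_eq0.
  - move=> x y; have := H x y; rewrite /sym_color /phi /=; case: ifP => ny /norm_color_inl[_] /=.
      by rewrite mulNr.
    (* For an edge coming from the previous part, I^2 = -1 lets the factor -I be pulled out; its
       norm is absorbed in the second coordinate of [phi]. *)
    have -> : ((point (h y).2).1 - I * (point (g x)).1 =
       - I * ((point (g x)).1 + I * (point (h y).2).1))%R.
      move: (point _).1 (point _).1 => V U.
      have -> : (- I * (V + I * U) = - (I * I) * U - I * V)%R by ring.
      by rewrite I2 opprK mul1r.
    rewrite qnormM => E; apply: (mulfI nI0); rewrite E; field; exact: nI0.
pose b : 'I_3 := ord_max; pose a : 'I_3 := ord0.
have gab : g a != g b by rewrite (inj_eq ginj).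
(* If the tag is [i], every edge leaves part [i], so all of [h] lies in the next part; otherwise
   every edge enters part [i] and all of [h] lies in part [j]. Either way first coordinates agree
   within each side, so digits differ. *)
have [ji|ji] := eqVneq j i.
  have D x y : [/\ next_part i (h y).1, ((point (g x)).1 = I * (point (h y).2).1)%R &
      digit_color s (digit (g x)) (digit (h y).2) = k].
    have := H x y; rewrite /sym_color /=; case: ifP => ny /norm_color_inr[] //.
    by move=> hj; move: (hi y); rewrite hj ji eqxx.
  have [n1 p1 d1] := D a a; have [n2 p2 d2] := D a b.
  have [_ p3 d3] := D b a; have [_ _ d4] := D b b.
  have hab : (h a).2 != (h b).2.
    apply/negP => /eqP hab; suff : a = b by [].
    by apply/hinj/injective_projections => //; exact: next_inj n1 n2.
  have V : (point (h a).2).1 = (point (h b).2).1 by apply: (mulfI I0); rewrite -p1 -p2.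
  have U : (point (g a)).1 = (point (g b)).1 by rewrite p1 p3.
  apply: (@digit_color_K22 s _ _ _ _ (digit_neq U gab) (digit_neq V hab)) => //.
  - by rewrite d1 d2.
  - by rewrite d3 d4.
  - by rewrite d1 d3.
have D x y : [/\ (h y).1 = j, ((point (h y).2).1 = I * (point (g x)).1)%R &
    digit_color s (digit (h y).2) (digit (g x)) = k].
  have := H x y; rewrite /sym_color /=; case: ifP => ny /norm_color_inr[] //.
  by move=> /= ij; rewrite ij eqxx in ji.
have [n1 p1 d1] := D a a; have [n2 p2 d2] := D a b.
have [_ p3 d3] := D b a; have [_ _ d4] := D b b.
have hab : (h a).2 != (h b).2.
  apply/negP => /eqP hab; suff : a = b by [].
  by apply/hinj/injective_projections => //; rewrite n1 n2.
have V : (point (h a).2).1 = (point (h b).2).1 by rewrite p1 p2.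
have U : (point (g a)).1 = (point (g b)).1 by apply: (mulfI I0); rewrite -p1 -p3.
apply: (@digit_color_K22 s _ _ _ _ (digit_neq V hab) (digit_neq U gab)) => //.
- by rewrite d1 d3.
- by rewrite d2 d4.
- by rewrite d1 d2.
Qed.

Lemma norm_coloring_not_arrows : ~ multipartite_arrows 3 m K33 n.
Proof.
apply: (@coloring_not_arrows m n _ colors norm_color) => //; last first.
- exact: norm_coloring_no_star.
- by apply: leq_trans Hm; rewrite addn_gt0 orbT.
Qed.

End NormColoring.

Theorem not_arrows_K33 (p e s m n : nat) : prime p -> odd p -> 0 < e -> 0 < s ->
  let q := p ^ e in
  q.-1 + 3 * (2 * (q.-1 %/ s) + s ^ 2).+1 <= m ->
  2 * n <= (q ^ 2 - 1) * q.-1 -> ~ multipartite_arrows 3 m K33 n.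
Proof.
move=> pp oddp e0 s0 q Hm Hn.
have e2 : 0 < e * 2 by rewrite muln_gt0 e0.
have [L pL cardL] := PrimePowerField pp e2.
rewrite expnM -/q in cardL.
have [I I2] := exists_sqrtN1 pL oddp e0 cardL.
exact: (norm_coloring_not_arrows pL oddp e0 cardL I2 s0 Hm Hn).
Qed.

(** * Arithmetic functions *)

From mathcomp Require Import all_classical all_reals all_analysis.
Import Order.TTheory Num.Theory.
Local Open Scope ring_scope.

Section Divisors.
Variable V : nmodType.
Implicit Types (f : nat -> V) (g : nat -> nat -> V).

Lemma sum_multiples f (d N : nat) : (0 < d)%N ->
  \sum_(1 <= n < N.+1 | (d %| n)%N) f (n %/ d)%N
  = \sum_(1 <= k < (N %/ d).+1) f k.
Proof.
move=> d0; elim: N => [|N IH]; first by rewrite div0n !big_geq.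
rewrite (@big_cat_nat _ _ _ N.+1) //= IH divnS // [X in _ + X]big_mkcond /= big_nat1.
case: ifP => dN; last by rewrite addr0.
rewrite [in RHS]add1n [in RHS](@big_cat_nat _ _ _ (N %/ d).+1) //= big_nat1.
by rewrite divnS // dN.
Qed.

Lemma sum_divisors_widen f (n N : nat) : (0 < n <= N)%N ->
  \sum_(1 <= d < N.+1 | (d %| n)%N) f d = \sum_(1 <= d < n.+1 | (d %| n)%N) f d.
Proof.
move=> /andP[n0 nN]; rewrite (@big_cat_nat _ _ _ n.+1) //= [X in _ + X]big_nat_cond.
rewrite [X in _ + X]big_pred0 ?addr0 // => d; apply/negP => /andP[/andP[nd _]].
by move=> /(dvdn_leq n0); rewrite leqNgt nd.
Qed.

Lemma sum_divisor_pairs g (N : nat) :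
  \sum_(1 <= d < N.+1) \sum_(1 <= k < (N %/ d).+1) g d k
  = \sum_(1 <= n < N.+1) \sum_(1 <= d < n.+1 | (d %| n)%N) g d (n %/ d)%N.
Proof.
transitivity (\sum_(1 <= d < N.+1) \sum_(1 <= n < N.+1 | (d %| n)%N)
    g d (n %/ d)%N).
  by apply: eq_big_nat => d /andP[d0 _]; rewrite (sum_multiples (g d)).
rewrite (exchange_big_dep_nat xpredT) //=; apply: eq_big_nat => n /andP[n0 nN].
by rewrite (sum_divisors_widen (fun d => g d (n %/ d)%N)) ?n0.
Qed.

(** Both sides run over the pairs with d e dividing n. *)
Lemma sum_divisors_pair g (n : nat) : (0 < n)%N ->
  \sum_(1 <= d < n.+1 | (d %| n)%N) \sum_(1 <= e < (n %/ d).+1 | (e %| n %/ d)%N)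
     g d e
  = \sum_(1 <= e < n.+1 | (e %| n)%N) \sum_(1 <= d < (n %/ e).+1 | (d %| n %/ e)%N)
     g d e.
Proof.
move=> n0.
have dvdE (d e : nat) : (0 < d)%N -> (0 < e)%N ->
    (d %| n)%N && (e %| n %/ d)%N = (d * e %| n)%N.
  move=> d0 e0; apply/andP/idP => [[dn en]|den].
    by rewrite -[n in (_ %| n)%N](divnK dn) [X in (_ %| X)%N]mulnC dvdn_pmul2l.
  have dn : (d %| n)%N by apply: dvdn_trans den; apply: dvdn_mulr.
  by split=> //; rewrite dvdn_divRL // mulnC.
pose h d e := if (d * e %| n)%N then g d e else 0.
transitivity (\sum_(1 <= d < n.+1) \sum_(1 <= e < n.+1) h d e).
  rewrite big_mkcond; apply: eq_big_nat => d /andP[d0 _]; case: ifP => dn; last first.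
    rewrite big_nat big1 // => e /andP[e0 _].
    by rewrite /h -dvdE ?dn.
  rewrite -(@sum_divisors_widen (g d) _ n); last first.
    by rewrite divn_gt0 // leq_div // andbT dvdn_leq.
  rewrite big_mkcond; apply: eq_big_nat => e /andP[e0 _].
  by rewrite /h -dvdE // dn.
rewrite exchange_big_nat /=.
rewrite [RHS]big_mkcond; apply: eq_big_nat => e /andP[e0 _]; case: ifP => en; last first.
  rewrite big_nat big1 // => d /andP[d0 _].
  by rewrite /h mulnC -dvdE ?en.
rewrite -(@sum_divisors_widen (g^~ e) _ n); last first.
  by rewrite divn_gt0 // leq_div // andbT dvdn_leq.
rewrite [RHS]big_mkcond; apply: eq_big_nat => d /andP[d0 _].
by rewrite /h mulnC -dvdE // en.
Qed.

(** Splits the divisors of p m by divisibility by p; this drives the evaluations of divisor sums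
    that strip one prime from n. *)
Lemma sum_divisors_prime f (p m : nat) : prime p -> (0 < m)%N ->
  \sum_(1 <= d < (p * m).+1 | (d %| p * m)%N) f d
  = \sum_(1 <= e < m.+1 | (e %| m)%N && ~~ (p %| e)%N) f e
    + \sum_(1 <= e < m.+1 | (e %| m)%N) f (p * e)%N.
Proof.
move=> pp m0; have p0 := prime_gt0 pp.
rewrite (bigID (fun d => p %| d)%N) /= addrC; congr (_ + _).
  transitivity (\sum_(1 <= d < (p * m).+1 | (d %| m)%N && ~~ (p %| d)%N) f d).
    apply: eq_bigl => d; case: (boolP (p %| d)%N) => pd; rewrite ?andbF ?andbT //.
    by rewrite Gauss_dvdr // coprime_sym prime_coprime.
  rewrite !big_mkcondr; apply: sum_divisors_widen.
  by rewrite m0 leq_pmull.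
transitivity (\sum_(1 <= d < (p * m).+1 | (p %| d)%N)
   (if (d %/ p %| m)%N then f (p * (d %/ p))%N else 0)).
  rewrite -big_mkcondr /=; apply: congr_big => // [d|d /andP[_ pd]].
    rewrite andbC; case: (boolP (p %| d)%N) => //= pd.
    by rewrite dvdn_divLR // mulnC.
  by rewrite mulnC divnK.
rewrite (sum_multiples (fun k => if (k %| m)%N then f (p * k)%N else 0)) //.
by rewrite mulKn // -big_mkcond.
Qed.

End Divisors.

Lemma primes_pM (p m : nat) : prime p -> (0 < m)%N ->
  primes (p * m) =i p :: primes m.
Proof.
by move=> pp m0 q; rewrite primesM ?(prime_gt0 pp) // primes_prime // !inE.
Qed.

Section Arithmetic.
Variable R : realType.

Definition moebius (n : nat) : R :=
  if all (fun p => logn p n == 1%N) (primes n) then (-1) ^+ size (primes n) else 0.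

Definition mangoldt (n : nat) : R := if primes n is [:: p] then ln p%:R else 0.

Lemma moebius_norm_le1 n : `|moebius n| <= 1.
Proof. by rewrite /moebius; case: ifP; rewrite ?normr0 // normrX normrN1 expr1n. Qed.

Lemma moebius_pM (p m : nat) : prime p -> (0 < m)%N ->
  moebius (p * m) = if (p %| m)%N then 0 else - moebius m.
Proof.
move=> pp m0; have p0 := prime_gt0 pp; have pm0 : (0 < p * m)%N by rewrite muln_gt0 p0.
case: ifP => pm.
  rewrite /moebius ifF //; apply/allPn; exists p.
    by rewrite mem_primes pp pm0 dvdn_mulr.
  rewrite lognM // logn_prime // eqxx add1n eqSS -lt0n logn_gt0.
  by rewrite mem_primes pp m0 pm.
have pN : p \notin primes m by rewrite mem_primes pm !andbF.
have per : perm_eq (primes (p * m)) (p :: primes m).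
  by apply: uniq_perm; [exact: primes_uniq|rewrite /= pN primes_uniq|exact: primes_pM].
rewrite /moebius (perm_all _ per) (perm_size per) /= exprS mulN1r.
rewrite lognM // logn_prime // eqxx add1n eqSS.
have -> : logn p m = 0%N by apply/eqP; rewrite -leqn0 leqNgt logn_gt0.
rewrite eqxx /= (_ : all _ _ = all (fun q => logn q m == 1%N) (primes m)).
  by case: ifP => // _; rewrite oppr0.
apply: eq_in_all => q qm; have qp : q != p by apply: contraNneq pN => <-.
by rewrite lognM // logn_prime // (negPf qp) add0n.
Qed.

(** For n = p m, the divisors e and p e with p not dividing e cancel, and those p e with p dividing
    e contribute 0. *)
Lemma sum_moebius (n : nat) : (0 < n)%N ->
  \sum_(1 <= d < n.+1 | (d %| n)%N) moebius d = (n == 1%N)%:R.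
Proof.
move=> n0; case: (ltngtP n 1) n0 => // [n1 _|-> _]; last first.
  by rewrite big_mkcond big_nat1.
have pp := pdiv_prime n1; set p := pdiv n in pp.
have := pdiv_dvd n; rewrite -/p => /dvdnP[m nE].
have m0 : (0 < m)%N by case: m nE n1 => [->|].
rewrite nE mulnC sum_divisors_prime //.
rewrite [X in _ + X]big_nat_cond [X in _ + X](eq_bigr
  (fun e => - if (p %| e)%N then 0 else moebius e)); last first.
  by move=> e /andP[/andP[e0 _] _]; rewrite moebius_pM //; case: ifP; rewrite ?oppr0.
rewrite -big_nat_cond sumrN [X in X - _]big_mkcondr [X in X - _](eq_bigr
  (fun e => if (p %| e)%N then 0 else moebius e)) ?subrr // => e _.
by case: (p %| e)%N.
Qed.

Lemma mangoldt_ge0 n : 0 <= mangoldt n.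
Proof.
rewrite /mangoldt; case E : (primes n) => [|p []] //.
have : p \in primes n by rewrite E inE.
rewrite mem_primes => /and3P[/prime_gt1 p1 _ _].
by rewrite ln_ge0 // ler1n ltnW.
Qed.

Lemma mangoldt_neq0 n : mangoldt n != 0 ->
  exists p k, [/\ prime p, (0 < k)%N & n = (p ^ k)%N].
Proof.
rewrite /mangoldt; case E : (primes n) => [|p []]; rewrite ?eqxx // => _.
have : p \in primes n by rewrite E inE.
rewrite mem_primes => /and3P[pp n0 pn]; exists p, (logn p n).
rewrite pp logn_gt0 E inE eqxx; split=> //.
rewrite -p_part part_pnat_id //; apply/pnatP => // q qp qn.
by move: (mem_primes q n); rewrite qp n0 qn E !inE.
Qed.

Lemma mangoldt_pM (p m : nat) : prime p -> (0 < m)%N ->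
  mangoldt (p * m) = if m == 1%N then ln p%:R
                     else if (p %| m)%N then mangoldt m else 0.
Proof.
move=> pp m0; have p0 := prime_gt0 pp.
case: eqVneq => [->|m1]; first by rewrite muln1 /mangoldt primes_prime.
case: ifP => pm.
  rewrite /mangoldt (_ : primes (p * m) = primes m) //.
  apply/eq_primes => q; rewrite primes_pM // inE.
  by case: eqVneq => // ->; rewrite mem_primes pp m0 pm.
rewrite /mangoldt; case E : (primes (p * m)) => [|q []] //.
have := primes_pM pp m0; rewrite E => H.
have := H p; rewrite !inE eqxx /= => /eqP pq.
have m1' : (1 < m)%N by case: (m) m0 m1 => [|[]].
have := H (pdiv m); rewrite !inE -pq mem_primes pdiv_prime // m0 pdiv_dvd orbT.
by move=> /eqP Ep; move: pm; rewrite -Ep pdiv_dvd.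
Qed.

Lemma sum_mangoldt (n : nat) : (0 < n)%N ->
  \sum_(1 <= d < n.+1 | (d %| n)%N) mangoldt d = ln n%:R.
Proof.
have [k] := ubnP n; elim: k n => // k IH n nk n0.
case: (ltngtP n 1) n0 => // [n1 _|-> _]; last first.
  by rewrite big_mkcond big_nat1 /= ln1.
have pp := pdiv_prime n1; set p := pdiv n in pp.
have := pdiv_dvd n; rewrite -/p => /dvdnP[m nE].
have m0 : (0 < m)%N by case: m nE n1 => [->|].
have p1 := prime_gt1 pp.
have mn : (m < n)%N by rewrite nE ltn_Pmulr.
rewrite nE mulnC sum_divisors_prime //.
rewrite [X in _ + X]big_nat_cond [X in _ + X](eq_bigr
  (fun e => (if e == 1%N then ln p%:R else 0) +
            (if (p %| e)%N then mangoldt e else 0))); last first.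
  move=> e /andP[/andP[e0 _] _]; rewrite mangoldt_pM //.
  case: eqVneq => [->|_]; last by rewrite add0r.
  by rewrite dvdn1 gtn_eqF // addr0.
rewrite -big_nat_cond big_split /= [X in _ + (X + _)](_ : _ = ln p%:R); last first.
  rewrite -big_mkcondr big_ltn_cond // dvd1n /= big_nat_cond big_pred0 ?addr0 //.
  by move=> e; case: eqVneq => [->|_] /=; rewrite ?ltnn ?andbF.
rewrite addrCA natrM lnM ?posrE ?ltr0n // ?(ltnW p1) //; congr (_ + _).
rewrite -[RHS]IH ?(leq_trans mn) // [RHS](bigID (fun e => p %| e)%N) /= addrC.
by rewrite -[in X in X + _]big_mkcondr.
Qed.

(** Expanding the logarithm by [sum_mangoldt] and exchanging the sums, [sum_moebius] leaves only e =
    n. *)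
Lemma sum_moebius_ln (n : nat) : (0 < n)%N ->
  \sum_(1 <= d < n.+1 | (d %| n)%N) moebius d * ln (n %/ d)%:R = mangoldt n.
Proof.
move=> n0.
transitivity (\sum_(1 <= d < n.+1 | (d %| n)%N)
   \sum_(1 <= e < (n %/ d).+1 | (e %| n %/ d)%N) moebius d * mangoldt e).
  rewrite big_nat_cond [RHS]big_nat_cond; apply: eq_bigr => d /andP[/andP[d0 _] dn].
  rewrite -sum_mangoldt ?divn_gt0 // ?mulr_sumr //; exact: dvdn_leq.
rewrite (sum_divisors_pair (fun d e => moebius d * mangoldt e)) //.
transitivity (\sum_(1 <= e < n.+1 | (e %| n)%N) (if e == n then mangoldt e else 0)).
  rewrite big_nat_cond [RHS]big_nat_cond; apply: eq_bigr => e /andP[/andP[e0 _] en].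
  have ne0 : (0 < n %/ e)%N by rewrite divn_gt0 // dvdn_leq.
  rewrite -mulr_suml (sum_moebius ne0) -(eqn_pmul2r e0) divnK // mul1n eq_sym.
  by case: eqP; rewrite ?mul1r ?mul0r.
rewrite big_mkcond big_nat_recr //= dvdnn eqxx big_nat big1 ?add0r // => e.
by move=> /andP[_ en]; rewrite (ltn_eqF en) if_same.
Qed.

End Arithmetic.

(** * Sums over the positive integers up to a real number *)

Section PartialSums.
Variable R : realType.
Implicit Types (h k : nat -> R) (x y u v : R).
Local Notation truncn := Num.truncn.

Definition psum h y : R := \sum_(1 <= n < (truncn y).+1) h n.

Lemma psum_lt1 h y : y < 1 -> psum h y = 0.
Proof.
move=> y1; rewrite /psum (_ : truncn y = 0%N) ?big_geq //.
by apply/eqP; rewrite -leqn0 truncn_le_nat.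
Qed.

Lemma psumB h u v : u <= v ->
  psum h v - psum h u = \sum_((truncn u).+1 <= n < (truncn v).+1) h n.
Proof.
move=> uv; rewrite /psum (@big_cat_nat _ _ _ (truncn u).+1) //=.
  by rewrite addrAC subrr add0r.
by rewrite ltnS; apply: le_truncn.
Qed.

Lemma psum_ler h k u v : u <= v ->
  (forall n : nat, (0 < n)%N -> u < n%:R <= v -> h n <= k n) ->
  psum h v - psum h u <= psum k v - psum k u.
Proof.
move=> uv hk; rewrite !psumB //; apply: ler_sum_nat => n /andP[un nv].
have n0 : (0 < n)%N by apply: leq_ltn_trans un.
apply: hk => //; apply/andP; split.
  by rewrite (lt_le_trans (truncnS_gt _)) // ler_nat.
by case: n n0 {un} nv => // n _; rewrite ltnS truncn_gt_nat.
Qed.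

Lemma psum_exists_lt h k u v : u <= v ->
  psum k v - psum k u < psum h v - psum h u ->
  exists n : nat, [/\ (0 < n)%N, u < n%:R <= v & k n < h n].
Proof.
move=> uv; rewrite ltNge => /negP H; apply: contrapT => N; apply: H.
apply: psum_ler => // n n0 nuv; rewrite leNgt; apply/negP => kn.
by apply: N; exists n.
Qed.

Lemma psum_le h k y : (forall n : nat, (0 < n)%N -> n%:R <= y -> h n <= k n) ->
  psum h y <= psum k y.
Proof.
move=> hk; rewrite /psum; apply: ler_sum_nat => n /andP[n0 ny].
by apply: hk => //; case: n n0 ny => // n _; rewrite ltnS truncn_gt_nat.
Qed.

Lemma eq_psum h k y : (forall n : nat, (0 < n)%N -> n%:R <= y -> h n = k n) ->
  psum h y = psum k y.
Proof.
by move=> hk; apply/le_anti/andP; split; apply: psum_le => n n0 ny; rewrite hk.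
Qed.

Lemma psum_mono h u v : (forall n, 0 <= h n) -> u <= v -> psum h u <= psum h v.
Proof.
move=> h0 uv; rewrite -subr_ge0 psumB //; apply: sumr_ge0 => n _; exact: h0.
Qed.

Lemma psum_ge0 h y : (forall n, 0 <= h n) -> 0 <= psum h y.
Proof. by move=> h0; apply: sumr_ge0 => n _; apply: h0. Qed.

Lemma psumD h k y : psum (fun n => h n + k n) y = psum h y + psum k y.
Proof. exact: big_split. Qed.

Lemma psumM c h y : psum (fun n => c * h n) y = c * psum h y.
Proof. by rewrite /psum mulr_sumr. Qed.

Lemma truncn_div x (d : nat) : truncn (x / d%:R) = (truncn x %/ d)%N.
Proof.
case: d => [|d]; first by rewrite invr0 mulr0 truncn0 divn0.
case: (ltP x 0) => x0.
  have -> : truncn x = 0%N by apply/eqP; rewrite -leqn0 truncn_le_nat; lra.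
  apply/eqP; rewrite div0n -leqn0 truncn_le_nat.
  by rewrite (@lt_trans _ _ 0) // pmulr_llt0 // invr_gt0 ltr0n.
have [xl xr] := andP (truncn_itv x0).
apply: truncn_def; rewrite ler_pdivlMr ?ltr0n // ltr_pdivrMr ?ltr0n //.
rewrite -!natrM; apply/andP; split.
  by apply: le_trans xl; rewrite ler_nat leq_divM.
by apply: lt_le_trans xr _; rewrite ler_nat -ltn_divLR.
Qed.

Lemma psum_pairs (g : nat -> nat -> R) x :
  psum (fun d => psum (g d) (x / d%:R)) x
  = psum (fun n => \sum_(1 <= d < n.+1 | (d %| n)%N) g d (n %/ d)%N) x.
Proof.
rewrite /psum -sum_divisor_pairs; apply: eq_big_nat => d _.
by rewrite truncn_div.
Qed.

End PartialSums.

(** * Stirling and harmonic estimates *)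

Section LogEstimates.
Variable R : realType.
Implicit Types (x y : R).
Local Notation truncn := Num.truncn.

Lemma ln_le_subr1 x : 0 < x -> ln x <= x - 1.
Proof.
move=> x0; have := @le_ln1Dx R (x - 1).
by rewrite [1 + _]addrC subrK; apply; lra.
Qed.

Lemma ln_ge_1subV x : 0 < x -> 1 - x^-1 <= ln x.
Proof.
move=> x0; have xV : 0 < x^-1 by rewrite invr_gt0.
by have := ln_le_subr1 xV; rewrite lnV ?posrE //; lra.
Qed.

Lemma lnB_le x y : 0 < x -> 0 < y -> ln y - ln x <= (y - x) / x.
Proof.
move=> x0 y0; rewrite -ln_div ?posrE // (le_trans (ln_le_subr1 _)) ?divr_gt0 //.
by rewrite mulrBl divff ?gt_eqF.
Qed.

Lemma lnB_ge x y : 0 < x -> 0 < y -> (y - x) / y <= ln y - ln x.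
Proof. by move=> x0 y0; have := lnB_le y0 x0; rewrite -[x - y]opprB mulNr; lra. Qed.

Lemma truncn_ge1 y : 1 <= y -> [/\ (0 < truncn y)%N, 1 <= (truncn y)%:R :> R,
  (truncn y)%:R <= y & y <= (truncn y)%:R + 1].
Proof.
move=> y1; have t0 : (0 < truncn y)%N by rewrite truncn_gt0.
have y0 : 0 <= y by lra.
have [yl yr] := andP (truncn_itv y0).
by split; rewrite ?ler1n // natr1 ltW.
Qed.

(** The induction step is N (ln(N+1) - ln N) <= 1 <= (N+1) (ln(N+1) - ln N). *)
Lemma ln_fact_bounds (N : nat) : (0 < N)%N ->
  let f := N%:R * ln N%:R - N%:R : R in
  f + 1 <= \sum_(1 <= n < N.+1) ln n%:R <= f + 1 + ln N%:R.
Proof.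
elim: N => // -[|N] IH _ /=.
  by rewrite big_nat1 ln1 mulr0 sub0r addNr addr0 lexx.
rewrite big_nat_recr //=; have /andP[H1 H2] := IH isT.
set S := \sum_(_ <= _ < _) _ in H1 H2 *.
set n : R := N.+1%:R in H1 H2 *.
have n0 : 0 < n by rewrite ltr0n.
rewrite -[N.+2]addn1 natrD -/n.
have n1 : 0 < n + 1 by lra.
have e1 : n + 1 - n = 1 by ring.
have := lnB_le n0 n1; rewrite e1 ler_pdivlMr // => B.
have := lnB_ge n0 n1; rewrite e1 ler_pdivrMr // => A.
apply/andP; split; lra.
Qed.

Lemma psum_ln y : 1 <= y ->
  `|psum (fun n => ln n%:R) y - (y * ln y - y)| <= 1 + ln y.
Proof.
move=> y1; have [t0 t1 ty yt] := truncn_ge1 y1.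
have /= := ln_fact_bounds t0; rewrite -/(psum _ _).
set T := psum _ _; set N : R := (truncn y)%:R in t1 ty yt * => /andP[T1 T2].
have N0 : 0 < N by lra.
have y0 : 0 < y by lra.
have lny : 0 <= ln y by apply: ln_ge0.
have lnN : ln N <= ln y by rewrite ler_ln ?posrE.
have A := lnB_le N0 y0; have B := lnB_ge N0 y0.
have A' : N * (ln y - ln N) <= y - N.
  by move: A; rewrite ler_pdivlMr // mulrC.
have C := ln_ge_1subV y0.
have B' : (y - N) * (N / y) <= N * (ln y - ln N).
  by have := ler_wpM2l (ltW N0) B; rewrite mulrCA.
have D : y^-1 <= N / y by rewrite ler_peMl // invr_ge0 ltW.
rewrite ler_norml; apply/andP; split; nra.
Qed.

(** The witness is Euler's constant, as the supremum of the increasing sequence [a]; the decreasing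
    sequence [b] bounds it from above, and b N - a N <= 1/N. *)
Lemma harmonic_ln : exists g : R, forall y, 1 <= y ->
  `|psum (fun n => n%:R^-1) y - ln y - g| <= 2 / y.
Proof.
pose H (N : nat) : R := \sum_(1 <= n < N.+1) n%:R^-1.
pose a (N : nat) := H N - ln N.+1%:R; pose b (N : nat) := H N - ln N%:R.
have step (N : nat) : N.+2%:R^-1 <= ln N.+2%:R - ln N.+1%:R :> R /\
   ln N.+2%:R - ln N.+1%:R <= N.+1%:R^-1 :> R.
  have n0 : 0 < N.+1%:R :> R by rewrite ltr0n.
  have n1 : 0 < N.+2%:R :> R by rewrite ltr0n.
  have := lnB_le n0 n1; have := lnB_ge n0 n1.
  by rewrite -(natrB _ (leqnSn _)) subSnn !mul1r.
have HS (N : nat) : H N.+1 = H N + N.+1%:R^-1 by rewrite /H big_nat_recr.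
have a_mono : {homo a : m n / (m <= n)%N >-> m <= n}.
  apply: homo_leq => //; first exact: le_trans.
  by move=> N; rewrite /a HS; have [_] := step N; move: (ln _) (ln _) (_^-1) (H N) => p q r s; lra.
have b_mono (m n : nat) : (0 < m)%N -> (m <= n)%N -> b n <= b m.
  move=> m0; elim: n => [|n IH]; first by rewrite leqn0 => /eqP ->.
  rewrite leq_eqVlt => /orP[/eqP -> //|]; rewrite ltnS => mn.
  apply: le_trans (IH mn); rewrite /b HS.
  case: n mn {IH} => [|n] mn; first by case: m m0 mn.
  by have [+ _] := step n; move: (ln _) (ln _) (_^-1) (H _) => p q r s; lra.
have ab (N : nat) : (0 < N)%N -> a N <= b N.
  by case: N => // N _; rewrite /a /b lerD2l lerN2 ler_ln ?posrE ?ltr0n ?ler_nat.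
have ab2 m n : (0 < n)%N -> a m <= b n.
  move=> n0; apply: le_trans (a_mono _ _ (leq_maxl m n)) _.
  apply: le_trans (ab _ _) _; first by rewrite leq_max n0 orbT.
  by apply: b_mono => //; rewrite leq_maxr.
pose E := [set a N | N in setT]%classic.
have E0 : (E !=set0)%classic by exists (a 0); exists 0.
exists (sup E) => y y1; have [t0 t1 ty yt] := truncn_ge1 y1.
set N := truncn y in t0 t1 ty yt *.
have g1 : a N <= sup E.
  apply: ub_le_sup; last by exists N.
  by exists (b 1%N) => _ [m _ <-]; apply: ab2.
have g2 : sup E <= b N by apply: ge_sup => // _ [m _ <-]; apply: ab2.
have y0 : 0 < y by lra.
have l1 : ln N%:R <= ln y by rewrite ler_ln ?posrE ?ltr0n.
have l2 : ln y <= ln N.+1%:R by rewrite ler_ln ?posrE ?ltr0n // -natr1.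
have : ln N.+1%:R - ln N%:R <= 2 / y.
  case: (N) t0 t1 yt => // M _ t1 yt; have [_ /le_trans -> //] := step M.
  have M0 : 0 < M.+1%:R :> R by rewrite ltr0n.
  rewrite ler_pdivlMr // mulrC ler_pdivrMr //; lra.
move: g1 g2; rewrite /a /b -/(H N) /psum -/(H N) => g1 g2 d.
rewrite ler_norml; apply/andP; split; lra.
Qed.

End LogEstimates.

Lemma sum_pairsC (V : nmodType) (g : nat -> nat -> V) (N : nat) :
  \sum_(1 <= d < N.+1) \sum_(1 <= k < (N %/ d).+1) g d k
  = \sum_(1 <= d < N.+1) \sum_(1 <= k < (N %/ d).+1) g k d.
Proof.
have H (f : nat -> nat -> V) :
    \sum_(1 <= d < N.+1) \sum_(1 <= k < (N %/ d).+1) f d k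
    = \sum_(1 <= d < N.+1) \sum_(1 <= k < N.+1) if (d * k <= N)%N then f d k else 0.
  apply: eq_big_nat => d /andP[d0 _].
  rewrite [RHS](@big_cat_nat _ _ _ (N %/ d).+1) //=; last by rewrite ltnS leq_div.
  rewrite [X in _ + X]big_nat_cond [X in _ + X]big1 ?addr0.
    rewrite big_nat_cond [RHS]big_nat_cond; apply: eq_bigr => k /andP[/andP[_ kN] _].
    by rewrite ifT // mulnC -leq_divRL.
  move=> k /andP[/andP[kN _] _].
  by rewrite ifF // mulnC -leq_divRL // leqNgt kN.
rewrite H (H (fun d k => g k d)) exchange_big_nat /=.
by apply: eq_bigr => d _; apply: eq_bigr => k _; rewrite mulnC.
Qed.

(** * Chebyshev's upper bound and Mertens' first theorem *)

Section Mertens.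
Variable R : realType.
Implicit Types (x y : R).
Local Notation truncn := Num.truncn.
Local Notation Lam := (mangoldt R).
Local Notation mu := (moebius R).

Definition chebyshev_psi (x : R) := psum Lam x.
Local Notation psi := chebyshev_psi.

Definition mertens_sum (x : R) := psum (fun n => Lam n / n%:R) x.
Local Notation Lsum := mertens_sum.

Lemma psum_psi x : psum (fun n => psi (x / n%:R)) x = psum (fun n => ln n%:R) x.
Proof.
transitivity (psum (fun d => psum (fun _ => Lam d) (x / d%:R)) x).
  rewrite /psum (eq_bigr (fun d => \sum_(1 <= k < (truncn x %/ d).+1) Lam k)).
    rewrite (sum_pairsC (fun _ k => Lam k)).
    by apply: eq_bigr => d _; rewrite truncn_div.
  by move=> d _; rewrite /psi /psum truncn_div.
rewrite (psum_pairs (fun d _ => Lam d)); apply: eq_psum => n n0 _.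
exact: sum_mangoldt.
Qed.

Lemma psum_ln_mangoldt x :
  psum (fun n => ln n%:R) x = psum (fun n => Lam n * (truncn (x / n%:R))%:R) x.
Proof.
transitivity (psum (fun d => psum (fun _ => Lam d) (x / d%:R)) x).
  rewrite (psum_pairs (fun d _ => Lam d)); apply: eq_psum => n n0 _.
  by rewrite sum_mangoldt.
apply: eq_psum => d d0 _; rewrite /psum sumr_const_nat subn1 /=.
by rewrite mulr_natr.
Qed.

Lemma psi_ge0 x : 0 <= psi x.
Proof. apply: psum_ge0 => n; exact: mangoldt_ge0. Qed.

Lemma psi_mono x y : x <= y -> psi x <= psi y.
Proof. apply: psum_mono => n; exact: mangoldt_ge0. Qed.

(** With T(y) the logarithm of the factorial of the integer part of y, T(y) - 2 T(y/2) gives every n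
    in (y/2, y] a coefficient of Λ(n) at least 1 and every smaller n a coefficient at least 0. *)
Lemma psi_half y : 2 <= y -> psi y - psi (y / 2) <= 4 * y.
Proof.
move=> y2; have yh : y / 2 <= y by lra.
pose k n := Lam n * (truncn (y / n%:R))%:R.
have y0 : 0 < y by lra.
have A : psi y - psi (y / 2) <= psum k y - psum k (y / 2).
  apply: psum_ler => // n n0 /andP[_ ny]; rewrite /k ler_peMr ?mangoldt_ge0 //.
  by rewrite ler1n truncn_gt0 ler_pdivlMr ?ltr0n // mul1r.
have B : 2 * psum (fun n => ln n%:R) (y / 2) <= psum k (y / 2).
  rewrite psum_ln_mangoldt -psumM; apply: psum_le => n n0 ny.
  rewrite /k mulrCA ler_wpM2l ?mangoldt_ge0 // -natrM ler_nat.
  have n0' : 0 < n%:R :> R by rewrite ltr0n.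
  rewrite truncn_ge_nat ?divr_ge0 ?(ltW y0) // natrM.
  have -> : y / n%:R = 2 * (y / 2 / n%:R) by field; lra.
  by rewrite ler_pM2l // truncn_le !divr_ge0 ?(ltW y0) ?ler0n.
have := psum_ln (_ : 1 <= y); rewrite psum_ln_mangoldt -/k => /(_ _)/ler_normlP.
move=> [|_ C]; first lra.
have := psum_ln (_ : 1 <= y / 2) => /(_ _)/ler_normlP[|D _]; first lra.
have E : ln (y / 2) = ln y - ln 2 by rewrite ln_div ?posrE.
have F : ln 2 <= 1 :> R by have := @ln_le_subr1 R 2; lra.
have G : 0 <= ln 2 :> R by apply: ln_ge0; lra.
have I := ln_le_subr1 y0.
rewrite E in D; nra.
Qed.

Lemma chebyshev_upper y : 0 <= y -> psi y <= 8 * y.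
Proof.
move=> y0; have [k] := ubnP (truncn y); elim: k y y0 => // k IH y y0 yk.
case: (ltP y 1) => y1; first by rewrite /psi psum_lt1 //; lra.
case: (ltP y 2) => y2.
  rewrite /psi /psum (_ : truncn y = 1%N); last by apply: truncn_def; rewrite y1.
  by rewrite big_nat1 /mangoldt /=; lra.
have /IH : (0 : R) <= y / 2 by lra.
have := psi_half y2 => A /(_ _) B.
suff : psi (y / 2) <= 8 * (y / 2) by lra.
apply: B; rewrite truncn_div -ltnS (leq_trans _ yk) // ltnS.
rewrite ltn_Pdiv // truncn_gt0; lra.
Qed.

(** Removing the truncation in the sum of Λ(n) times the integer part of x/n costs at most psi(x) <=
    8x; the rest is Stirling. *)
Lemma mertens_first x : 1 <= x -> `|Lsum x - ln x| <= 10.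
Proof.
move=> x1; have x0 : 0 < x by lra.
have := psum_ln x1; rewrite psum_ln_mangoldt.
set T := psum _ _ => H.
have A : T <= x * Lsum x.
  rewrite /T /Lsum -psumM; apply: psum_le => n n0 nx.
  rewrite mulrCA ler_wpM2l ?mangoldt_ge0 // truncn_le divr_ge0 //; lra.
have B : x * Lsum x - psi x <= T.
  rewrite /T /Lsum -psumM lerBlDr -psumD; apply: psum_le => n n0 nx.
  rewrite mulrCA -[X in _ + X]mulr1 -mulrDr ler_wpM2l ?mangoldt_ge0 // natr1.
  by rewrite ltW // truncnS_gt.
have C := chebyshev_upper (ltW x0).
have D := ln_le_subr1 x0.
move: H; rewrite ler_norml => /andP[E F].
rewrite -(ler_pM2l x0) -[X in X * `|_|](gtr0_norm x0) -normrM ler_norml.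
apply/andP; split; nra.
Qed.

Lemma psum_sqrt x : 1 <= x -> psum (fun n => Num.sqrt (x / n%:R)) x <= 2 * x.
Proof.
move=> x1; have [t0 t1 tx _] := truncn_ge1 x1; have x0 : 0 < x by lra.
have H (N : nat) : \sum_(1 <= n < N.+1) (Num.sqrt (n%:R : R))^-1 <= 2 * Num.sqrt N%:R.
  elim: N => [|N IH]; first by rewrite big_geq // sqrtr0 mulr0.
  rewrite big_nat_recr //=.
  set S := \sum_(_ <= _ < _) _ in IH *.
  set a := Num.sqrt N%:R in IH *; set b := Num.sqrt N.+1%:R.
  have a0 : 0 <= a by apply: sqrtr_ge0.
  have b0 : 0 < b by rewrite sqrtr_gt0 ltr0n.
  have a2 : a ^+ 2 = N%:R by rewrite sqr_sqrtr ?ler0n.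
  have b2 : b ^+ 2 = N%:R + 1 by rewrite sqr_sqrtr ?ler0n // -natr1.
  suff : b^-1 <= 2 * (b - a) by lra.
  rewrite -div1r ler_pdivrMr //; move: (N%:R) a2 b2 => n; nra.
rewrite (@eq_psum _ _ (fun n => Num.sqrt x * (Num.sqrt (n%:R : R))^-1)); last first.
  by move=> n n0 _; rewrite sqrtrM ?ltW // sqrtrV ?ler0n.
rewrite psumM; apply: (@le_trans _ _ (Num.sqrt x * (2 * Num.sqrt x))).
  rewrite ler_wpM2l ?sqrtr_ge0 //; apply: le_trans (H _) _.
  by rewrite ler_pM2l //; apply: ler_wsqrtr.
by rewrite mulrCA -expr2 sqr_sqrtr // ltW.
Qed.

(** From ln y = 4 ln(y^(1/4)) <= 4 (y^(1/4) - 1). *)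
Lemma sqr_ln_le_sqrt y : 1 <= y -> (1 + ln y) ^+ 2 <= 16 * Num.sqrt y.
Proof.
move=> y1; set r := Num.sqrt y.
have r0 : 0 < r by rewrite sqrtr_gt0; lra.
have s0 : 0 < Num.sqrt r by rewrite sqrtr_gt0.
have rE : Num.sqrt r ^+ 2 = r by rewrite sqr_sqrtr ?ltW.
have yE : r ^+ 2 = y by rewrite sqr_sqrtr //; lra.
have l0 := ln_ge0 y1.
have := ln_le_subr1 s0.
have : ln y = 4 * ln (Num.sqrt r).
  by rewrite -yE lnXn // -{1}rE lnXn // -mulrnA mulr_natl.
nra.
Qed.

End Mertens.

(** * Selberg's formula *)

Section Selberg.
Variable R : realType.
Implicit Types (x y : R).
Local Notation truncn := Num.truncn.
Local Notation Lam := (mangoldt R).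
Local Notation mu := (moebius R).
Local Notation psi := (@chebyshev_psi R).
Local Notation Lsum := (@mertens_sum R).

(* Möbius inversion with a logarithmic weight. *)
Lemma tatuzawa_iseki (F : R -> R) x : 1 <= x ->
  psum (fun d => mu d * ln (x / d%:R) *
                 psum (fun k => F (x / d%:R / k%:R)) (x / d%:R)) x
  = F x * ln x + psum (fun n => Lam n * F (x / n%:R)) x.
Proof.
move=> x1; have x0 : 0 < x by lra.
pose g d k := mu d * ln (x / d%:R) * F (x / d%:R / k%:R).
transitivity (psum (fun d => psum (g d) (x / d%:R)) x).
  by apply: eq_psum => d _ _; rewrite -psumM.
rewrite psum_pairs.
transitivity (psum (fun n => (if n == 1%N then F x * ln x else 0) +
    Lam n * F (x / n%:R)) x).
  apply: eq_psum => n n0 _; have n0' : 0 < n%:R :> R by rewrite ltr0n.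
  transitivity (\sum_(1 <= d < n.+1 | (d %| n)%N)
     (ln (x / n%:R) * F (x / n%:R) * mu d + F (x / n%:R) * (mu d * ln (n %/ d)%:R))).
    rewrite big_nat_cond [RHS]big_nat_cond.
    apply: eq_bigr => d /andP[/andP[d0 _] dn]; rewrite /g.
    have d0' : 0 < d%:R :> R by rewrite ltr0n.
    have e0 : 0 < (n %/ d)%:R :> R by rewrite ltr0n divn_gt0 // dvdn_leq.
    have nE : n%:R = d%:R * (n %/ d)%:R :> R by rewrite -natrM mulnC divnK.
    have -> : x / d%:R / (n %/ d)%:R = x / n%:R by rewrite nE invfM mulrA.
    have -> : ln (x / d%:R) = ln (x / n%:R) + ln (n %/ d)%:R.
      by rewrite -lnM ?posrE ?divr_gt0 // nE; congr ln; field; rewrite !gt_eqF.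
    by ring.
  rewrite big_split /= -!mulr_sumr sum_moebius // sum_moebius_ln // mulrC.
  congr (_ + _); last by rewrite mulrC.
  by case: eqP => [->|_]; rewrite ?mul0r // mul1r divr1 mulrC.
rewrite psumD; congr (_ + _).
have [t0 _ _ _] := truncn_ge1 x1.
rewrite /psum big_ltn // eqxx big_nat_cond big1 ?addr0 // => n.
by move=> /andP[/andP[n1 _] _]; rewrite gtn_eqF.
Qed.

Definition selberg_sum x := psi x * ln x + psum (fun n => Lam n * psi (x / n%:R)) x.

(** [tatuzawa_iseki] is applied to psi(y) - y plus a constant. The inner sums are O(1 + ln y), so
    the Möbius side is bounded by a sum of O(sqrt(x/n)), which is O(x); Mertens' theorem evaluates
    the other side. *)
Lemma selberg_formula : exists2 C : R, 0 < C &
  forall x, 1 <= x -> `|selberg_sum x - 2 * x * ln x| <= C * x.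
Proof.
have [g Hg] := harmonic_ln R.
(* The constant [g + 1] makes the sum of [F (y / k)] over [k <= y] logarithmic. *)
pose F y := psi y - y + (g + 1).
pose C0 := 4 + `|g + 1|.
have C0_gt0 : 0 < C0 by rewrite /C0; have := normr_ge0 (g + 1); lra.
have HF y : 1 <= y -> `|psum (fun k => F (y / k%:R)) y| <= C0 * (1 + ln y).
  move=> y1; have [t0 t1 ty yt] := truncn_ge1 y1; have y0 : 0 < y by lra.
  have -> : psum (fun k => F (y / k%:R)) y =
    psum (fun n => ln n%:R) y - y * psum (fun n => n%:R^-1) y
       + (g + 1) * (truncn y)%:R.
    rewrite -psum_psi -psumM /psum /F !big_split /= sumrN !sumr_const_nat.
    by rewrite !subn1 /= mulr_natr mulrnDl.
  have := psum_ln y1; have := Hg _ y1.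
  set h := psum _ y; set T := psum _ y; set t : R := (truncn y)%:R in t1 ty yt *.
  have -> : T - y * h + (g + 1) * t =
    (T - (y * ln y - y)) - y * (h - ln y - g) + (g + 1) * (t - y) by ring.
  move=> A B; have l0 := ln_ge0 y1.
  have A' : `|y * (h - ln y - g)| <= 2.
    by rewrite normrM gtr0_norm // mulrC -ler_pdivlMr.
  have B' : `|(g + 1) * (t - y)| <= `|g + 1|.
    by rewrite normrM ler_piMr // ler_norml; lra.
  have D := ler_normD (T - (y * ln y - y) - y * (h - ln y - g)) ((g + 1) * (t - y)).
  have E := ler_normB (T - (y * ln y - y)) (y * (h - ln y - g)).
  have G : 0 <= `|g + 1| * ln y by rewrite mulr_ge0.
  rewrite /C0; lra.
exists (C0 * 32 + 8 * `|g + 1| + `|g + 1| + 10); first by have := normr_ge0 (g + 1); lra.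
move=> x x1; have x0 : 0 < x by lra.
have := tatuzawa_iseki F x1; set Z := psum _ x => ZE.
have HZ : `|Z| <= C0 * 32 * x.
  apply: le_trans (ler_norm_sum _ _ _) _.
  apply: (@le_trans _ _ (psum (fun n => C0 * 16 * Num.sqrt (x / n%:R)) x)).
    apply: psum_le => n n0 nx.
    have n0' : 0 < n%:R :> R by rewrite ltr0n.
    have y1 : 1 <= x / n%:R by rewrite ler_pdivlMr // mul1r.
    have l0 := ln_ge0 y1.
    rewrite !normrM; apply: (@le_trans _ _ (1 * ln (x / n%:R) * (C0 * (1 + ln (x / n%:R))))).
      apply: ler_pM; rewrite ?mulr_ge0 //; last exact: HF.
      by apply: ler_pM => //; [exact: moebius_norm_le1|rewrite ger0_norm].
    have := sqr_ln_le_sqrt y1; move: (ln _) (Num.sqrt _) l0 => l s l0 ls.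
    rewrite mul1r -mulrA mulrCA ler_pM2l //; nra.
  rewrite psumM -!mulrA ler_pM2l //; have := psum_sqrt x1; lra.
have E2 : psum (fun n => Lam n * F (x / n%:R)) x =
   psum (fun n => Lam n * psi (x / n%:R)) x - x * Lsum x + (g + 1) * psi x.
  rewrite -!psumM -sumrN /psum -!big_split /=; apply: eq_bigr => n _.
  by rewrite /F; ring.
move: ZE; rewrite E2 => ZE.
have -> : selberg_sum x - 2 * x * ln x =
  Z - (g + 1) * ln x + x * (Lsum x - ln x) - (g + 1) * psi x.
  by rewrite ZE /selberg_sum /F; ring.
have M : `|x * (Lsum x - ln x)| <= 10 * x.
  by rewrite normrM gtr0_norm // mulrC ler_pM2r // mertens_first.
have P : `|(g + 1) * psi x| <= `|g + 1| * (8 * x).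
  rewrite normrM ler_wpM2l // ger0_norm ?psi_ge0 //.
  by apply: chebyshev_upper; lra.
have Q : `|(g + 1) * ln x| <= `|g + 1| * x.
  rewrite normrM ler_wpM2l // ger0_norm ?ln_ge0 //.
  by have := ln_le_subr1 x0; lra.
have N1 := ler_normB (Z - (g + 1) * ln x + x * (Lsum x - ln x)) ((g + 1) * psi x).
have N2 := ler_normD (Z - (g + 1) * ln x) (x * (Lsum x - ln x)).
have N3 := ler_normB Z ((g + 1) * ln x).
lra.
Qed.

End Selberg.

(** * Prime powers in short intervals *)

Section ShortIntervals.
Variable R : realType.
Implicit Types (x y u v w : R).
Local Notation truncn := Num.truncn.
Local Notation Lam := (mangoldt R).
Local Notation psi := (@chebyshev_psi R).
Local Notation Lsum := (@mertens_sum R).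

Lemma selberg_convolution_mono u v : 0 <= u -> u <= v ->
  psum (fun n => Lam n * psi (u / n%:R)) u <= psum (fun n => Lam n * psi (v / n%:R)) v.
Proof.
move=> u0 uv; apply: le_trans (psum_mono _ uv); last first.
  by move=> n; rewrite mulr_ge0 ?mangoldt_ge0 ?psi_ge0.
apply: psum_le => n n0 _; rewrite ler_wpM2l ?mangoldt_ge0 //.
by apply: psi_mono; rewrite ler_pM2r // invr_gt0 ltr0n.
Qed.

Lemma psi_short_interval : exists2 C : R, 0 < C & forall u v,
  1 <= u -> u <= v -> v <= 2 * u ->
  psi v - psi u <= 2 * (v - u) + C * (u / (1 + ln u)).
Proof.
have [C C0 HC] := selberg_formula R.
exists (20 + 3 * C); first lra.
move=> u v u1 uv v2; have u0 : 0 < u by lra.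
have v0 : 0 < v by lra.
have v1 : 1 <= v by lra.
have := HC _ u1; have := HC _ v1; rewrite !ler_norml => /andP[_ Sv] /andP[Su _].
have M := selberg_convolution_mono (ltW u0) uv.
have P : psi u <= psi v by apply: psi_mono.
have P0 := psi_ge0 u.
have Q := chebyshev_upper (ltW v0).
have lu := ln_ge0 u1.
have luv : ln u <= ln v by rewrite ler_ln ?posrE.
have l := lnB_le u0 v0.
have l' : v * (ln v - ln u) <= v.
  rewrite ger_pMr //; apply: le_trans l _; rewrite ler_pdivrMr //; lra.
have c0 : 0 < 1 + ln u by lra.
suff : (psi v - psi u) * (1 + ln u) <= 2 * (v - u) * (1 + ln u) + (20 + 3 * C) * u.
  by rewrite -ler_pdivlMr // mulrDl mulfK ?gt_eqF // mulrA.
have H : (psi v - psi u) * ln u <= selberg_sum v - selberg_sum u.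
  rewrite /selberg_sum; have : psi v * ln u <= psi v * ln v.
    by rewrite ler_wpM2l // psi_ge0.
  lra.
have I : C * v <= C * (2 * u) by rewrite ler_pM2l.
have J : selberg_sum v - selberg_sum u <= 2 * (v * (ln v - ln u)) + 2 * (v - u) * ln u
   + 3 * C * u by lra.
lra.
Qed.

Lemma psi_short_interval_eps tau : 0 < tau -> exists2 w0 : R, 1 <= w0 & forall u v,
  w0 <= u -> u <= v -> v <= 2 * u -> psi v - psi u <= 2 * (v - u) + tau * u.
Proof.
move=> t0; have [C C0 HC] := psi_short_interval.
exists (expR (C / tau)); first by rewrite -expR0 ler_expR ltW // divr_gt0.
move=> u v wu uv v2; have u0 : 0 < u by apply: lt_le_trans wu; apply: expR_gt0.
have u1 : 1 <= u.
  by apply: le_trans wu; rewrite -expR0 ler_expR ltW // divr_gt0.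
apply: le_trans (HC _ _ u1 uv v2) _.
have : C / tau <= ln u by rewrite -[C / tau]expRK ler_ln ?posrE ?expR_gt0.
rewrite ler_pdivrMr // => lu; have l0 := ln_ge0 u1.
rewrite lerD2l mulrA ler_pdivrMr; last lra.
by rewrite mulrAC ler_pM2r //; lra.
Qed.

Lemma mertens_recent K x : 1 <= K -> 1 <= x ->
  psum (fun n => Lam n / n%:R * (x / K < n%:R)%R%:R) x <= ln K + 20.
Proof.
move=> K1 x1; set h := (fun n : nat => _).
have K0 : 0 < K by lra. have x0 : 0 < x by lra.
have xK : x / K <= x by rewrite ler_pdivrMr // ler_peMr // ltW.
have hle (n : nat) : h n <= Lam n / n%:R.
  by rewrite /h; case: (_ < _); rewrite ?mulr1 // mulr0 divr_ge0 ?mangoldt_ge0.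
have A : psum h x - psum h (x / K) <= Lsum x - Lsum (x / K).
  by apply: psum_ler => // n _ _; apply: hle.
have B : psum h (x / K) <= psum (fun _ => 0) (x / K).
  by apply: psum_le => n _ nx; rewrite /h ltNge nx mulr0.
have C : psum (fun _ => 0) (x / K) = 0 by rewrite /psum big1.
have := mertens_first x1; rewrite ler_norml => /andP[_ D].
have lE : ln (x / K) = ln x - ln K by rewrite ln_div ?posrE.
have E : ln (x / K) - 10 <= Lsum (x / K).
  case: (lerP 1 (x / K)) => [xK1|xK1].
    by have := mertens_first xK1; rewrite ler_norml; lra.
  have l : ln (x / K) <= 0 by apply: ln_le0; rewrite ltW.
  have : 0 <= Lsum (x / K).
    by apply: psum_ge0 => n; rewrite divr_ge0 ?mangoldt_ge0.
  lra.
lra.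
Qed.

(** With ln K = 1/k, the terms n <= x/K have weight at most k, and the terms beyond x/K have bounded
    total by [mertens_recent]. So the errors of [psi_short_interval] add up to an arbitrarily small
    multiple of ln x. *)
Lemma mertens_weighted k : 0 < k -> exists C : R, forall x, 1 <= x ->
  psum (fun n => Lam n / n%:R * (1 + ln (x / n%:R))^-1) x <= k * ln x + C.
Proof.
move=> k0; set K := expR k^-1.
have K1 : 1 <= K by rewrite -expR0 ler_expR invr_ge0 ltW.
have K0 : 0 < K by lra.
exists (10 * k + (ln K + 20)) => x x1.
have x0 : 0 < x by lra.
apply: (@le_trans _ _ (k * Lsum x + psum (fun n => Lam n / n%:R * (x / K < n%:R)%R%:R) x)).
  rewrite -psumM -psumD; apply: psum_le => n n0 nx.
  have n0' : 0 < n%:R :> R by rewrite ltr0n.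
  rewrite [k * _]mulrC -mulrDr ler_wpM2l ?divr_ge0 ?mangoldt_ge0 //.
  have y1 : 1 <= x / n%:R by rewrite ler_pdivlMr // mul1r.
  have l0 := ln_ge0 y1.
  case: ltP => [_|nK].
    by rewrite mulr1n (@le_trans _ _ 1) ?invf_le1 //; lra.
  have : K <= x / n%:R by rewrite ler_pdivlMr // mulrC -ler_pdivlMr.
  rewrite -ler_ln ?posrE ?divr_gt0 // expRK => kl.
  rewrite addr0 -[k]invrK lef_pV2 ?posrE ?invr_gt0 //; lra.
have := mertens_recent K1 x1; have := mertens_first x1.
rewrite ler_norml => /andP[_ A] B.
have : k * Lsum x <= k * (ln x + 10) by rewrite ler_pM2l //; lra.
lra.
Qed.

(* The upper bound on primes in short intervals is [2 (lam - 1) y] for the interval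
   (y, lam y]; [n] is sparse when (x/n, lam x/n] misses it by [tau]. *)
Definition sparse_at (lam tau x : R) (n : nat) : bool :=
  psi (lam * (x / n%:R)) - psi (x / n%:R) < (2 * (lam - 1) - tau) * (x / n%:R).

Definition sparse_sum (lam tau x : R) : R -> R :=
  psum (fun n => Lam n / n%:R * (sparse_at lam tau x n)%:R).

Lemma sparse_sum_mono lam tau x u v : u <= v ->
  sparse_sum lam tau x u <= sparse_sum lam tau x v.
Proof.
by apply: psum_mono => n; rewrite mulr_ge0 ?ler0n // divr_ge0 ?mangoldt_ge0.
Qed.

(** With no prime power in (x, lam x], subtracting Selberg's formula at x from that at lam x makes
    the average increment of psi over (x/n, lam x/n] maximal, so the deficits at sparse n are of
    lower order. *)
Lemma sparse_sum_upper lam tau k : 1 < lam -> lam <= 2 -> 0 < tau -> 0 < k ->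
  exists C : R, forall x, 1 <= x -> psi (lam * x) <= psi x ->
    sparse_sum lam tau x x <= k * ln x + C.
Proof.
move=> lam1 lam2 t0 k0.
have [C C0 HC] := selberg_formula R.
have [C2 C20 HC2] := psi_short_interval.
have k'0 : 0 < k * tau / C2 by rewrite divr_gt0 // mulr_gt0.
have [D HD] := mertens_weighted k'0.
exists ((20 * (lam - 1) + 3 * C + 8 + C2 * D) / tau) => x x1 gap.
have x0 : 0 < x by lra.
have lx1 : x <= lam * x by rewrite ler_peMl // ltW.
have lx2 : lam * x <= 2 * x by rewrite ler_pM2r.
have psiE : psi (lam * x) = psi x by apply/le_anti; rewrite gap psi_mono.
have lx0 : 0 < lam * x by lra.
have lx : 0 <= ln x by apply: ln_ge0.
have llam : 0 < ln lam by apply: ln_gt0.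
have llam' : ln lam <= 1 by have := @ln_le_subr1 R lam; lra.
have lE : ln (lam * x) = ln lam + ln x by rewrite lnM ?posrE //; lra.
pose g y := psi (lam * y) - psi y.
have S1 : 2 * (lam - 1) * x * ln x - (3 * C + 8) * x
    <= psum (fun n => Lam n * g (x / n%:R)) x.
  have := HC _ x1; rewrite ler_norml => /andP[_].
  have := HC (lam * x); rewrite ler_norml => /(_ _)/andP[|+ _]; first lra.
  rewrite /selberg_sum psiE lE.
  (* The convolution terms with x < n <= lam x vanish in total, because psi is constant there. *)
  have A : psum (fun n => Lam n * psi (lam * x / n%:R)) (lam * x)
      - psum (fun n => Lam n * psi (lam * x / n%:R)) x
      <= psum (fun n => psi lam * Lam n) (lam * x) - psum (fun n => psi lam * Lam n) x.
    apply: psum_ler => // n n0 /andP[xn _]; have n0' : 0 < n%:R :> R by rewrite ltr0n.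
    rewrite [leRHS]mulrC ler_wpM2l ?mangoldt_ge0 //; apply: psi_mono.
    by rewrite ler_pdivrMr // ler_pM2l ?ltW //; lra.
  rewrite !psumM -/(psi (lam * x)) -/(psi x) psiE subrr in A.
  have -> : psum (fun n => Lam n * g (x / n%:R)) x =
     psum (fun n => Lam n * psi (lam * x / n%:R)) x
     - psum (fun n => Lam n * psi (x / n%:R)) x.
    rewrite /psum -sumrN -big_split; apply: eq_bigr => n _ /=.
    by rewrite /g mulrBr mulrA.
  have P0 := psi_ge0 x; have P := chebyshev_upper (ltW x0).
  have B : psi x * ln lam <= psi x by rewrite ler_piMr.
  have B2 : C * (lam * x) <= C * (2 * x) by rewrite ler_pM2l.
  have B3 : 0 <= lam * x * ln lam by rewrite mulr_ge0 // ltW.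
  lra.
(* Term by term: the short-interval bound holds for every n, and a sparse n falls short of its main
   term by tau x/n. *)
have S2 : psum (fun n => Lam n * g (x / n%:R)) x + tau * x * sparse_sum lam tau x x
   <= 2 * (lam - 1) * x * Lsum x +
      C2 * x * psum (fun n => Lam n / n%:R * (1 + ln (x / n%:R))^-1) x.
  rewrite -!psumM -!psumD; apply: psum_le => n n0 nx.
  have n0' : 0 < n%:R :> R by rewrite ltr0n.
  have y1 : 1 <= x / n%:R by rewrite ler_pdivlMr // mul1r.
  have y0 : 0 < x / n%:R by lra.
  have l0 := ln_ge0 y1.
  set s := (sparse_at _ _ _ _)%:R.
  suff : g (x / n%:R) + tau * (x / n%:R) * s <=
      2 * (lam - 1) * (x / n%:R) + C2 * (x / n%:R / (1 + ln (x / n%:R))).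
    move=> /(ler_wpM2l (mangoldt_ge0 R n)); congr (_ <= _); ring.
  rewrite /s /sparse_at -/(g _); case: ltP => [bad|_].
    have : 0 <= C2 * (x / n%:R / (1 + ln (x / n%:R))).
      apply: mulr_ge0; first exact: ltW.
      by apply: divr_ge0; [apply: ltW|lra].
    rewrite mulr1n; lra.
  rewrite mulr0n mulr0 addr0; have := HC2 _ (lam * (x / n%:R)) y1.
  rewrite -/(g _) ler_peMl ?(ltW y0) ?(ltW lam1) //.
  rewrite ler_pM2r // => /(_ isT lam2); lra.
have HV := HD _ x1; set V := psum _ x in HV; rewrite -/V in S2.
have := mertens_first x1; rewrite ler_norml => /andP[_ A].
have S3 : 2 * (lam - 1) * x * Lsum x <= 2 * (lam - 1) * x * (ln x + 10).
  apply: ler_wpM2l; last lra.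
  by apply: mulr_ge0; [apply: mulr_ge0; [|lra]|apply: ltW].
have S4 : C2 * x * V <= C2 * x * (k * tau / C2 * ln x + D).
  by apply: ler_wpM2l => //; apply: mulr_ge0; apply: ltW.
have E : C2 * (k * tau / C2 * ln x + D) = k * tau * ln x + C2 * D.
  by field; lra.
rewrite [C2 * x]mulrC -[X in _ <= X]mulrA E in S4.
rewrite -(ler_pM2l (mulr_gt0 x0 t0)).
have -> : x * tau * (k * ln x + (20 * (lam - 1) + 3 * C + 8 + C2 * D) / tau) =
   x * (k * tau * ln x + (20 * (lam - 1) + 3 * C + 8 + C2 * D)) by field; lra.
lra.
Qed.

End ShortIntervals.

(** * Erdős' back-and-forth argument *)

Section GapArgument.
Variable R : realType.
Implicit Types (x y u v w : R).
Local Notation truncn := Num.truncn.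
Local Notation Lam := (mangoldt R).
Local Notation psi := (@chebyshev_psi R).
Local Notation Lsum := (@mertens_sum R).

Lemma telescope_le (f : nat -> R) c (m k : nat) :
  (forall i, (m <= i < m + k)%N -> f i.+1 - f i <= c) ->
  f (m + k)%N - f m <= k%:R * c.
Proof.
elim: k => [|k IH] H; first by rewrite addn0 subrr mul0r.
have A := H (m + k)%N; rewrite addnS ltnSn leq_addr in A; have {}A := A isT.
have B : f (m + k)%N - f m <= k%:R * c.
  by apply: IH => i /andP[mi ik]; apply: H; rewrite mi addnS ltnS ltnW.
rewrite addnS -[k.+1]addn1 natrD mulrDl mul1r; lra.
Qed.

Lemma telescope_ge (f : nat -> R) c (m k : nat) :
  (forall i, (m <= i < m + k)%N -> c <= f i.+1 - f i) ->
  k%:R * c <= f (m + k)%N - f m.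
Proof.
move=> H; have := @telescope_le (fun i => - f i) (- c) m k.
rewrite mulrN => A; have {}A := A _.
suff: - f (m + k)%N - - f m <= - (k%:R * c) by lra.
by apply: A => i /H; lra.
Qed.

Section Window.
Variable mu : R.
Hypotheses (mu1 : 1 < mu) (mu54 : mu <= 5 / 4).
Let lam := mu ^+ 3.
Let tau := (mu - 1) / 20.
Let c := (mu - 1) / 2.

Let lam1 : 1 < lam. Proof. by rewrite exprn_egt1. Qed.

Let lam2 : lam <= 2.
Proof.
have m1 := mu1; apply: (@le_trans _ _ ((5 / 4) ^+ 3)); last by lra.
by rewrite /lam lerXn2r ?nnegrE //; lra.
Qed.

Variable w0 : R.
Hypothesis w01 : 1 <= w0.
Hypothesis Hw0 : forall u v, w0 <= u -> u <= v -> v <= 2 * u ->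
  psi v - psi u <= 2 * (v - u) + tau * u.

(** The interval (y, lam y], y = x/n, has nearly density 2, and its pieces outside (u, mu u] have at
    most about that density. The cell keeps (2 - 1/5)(mu - 1) u, and dividing by mu u with mu <= 5/4
    leaves more than 7/5 (mu - 1). *)
Lemma cell_full x (n : nat) u : (0 < n)%N -> w0 <= x / n%:R -> x / n%:R <= u ->
  mu * u <= lam * (x / n%:R) -> ~~ sparse_at lam tau x n ->
  7 / 5 * (mu - 1) <= Lsum (mu * u) - Lsum u.
Proof.
have m1 := mu1; have m54 := mu54; have l1 := lam1; have l2 := lam2; have w1 := w01.
move=> n0 wy yu uy; rewrite /sparse_at -leNgt.
set y := x / n%:R in wy yu uy *; move: y wy yu uy => y wy yu uy good.
have y0 : 0 < y by lra. have u0 : 0 < u by lra.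
have uu : u <= mu * u by rewrite ler_peMl // ltW.
have ly : lam * y <= 2 * y by rewrite ler_pM2r.
have A := Hw0 wy yu (_ : u <= 2 * y).
have {}A : psi u - psi y <= 2 * (u - y) + tau * y by apply: A; lra.
have B : psi (lam * y) - psi (mu * u) <= 2 * (lam * y - mu * u) + tau * (mu * u).
  by apply: Hw0; lra.
have ty : tau * y <= tau * u by rewrite ler_wpM2l // /tau; lra.
have ty2 : tau * (mu * u) <= tau * (2 * u).
  by rewrite ler_wpM2l ?ler_wpM2r // /tau; lra.
have C : (2 * (mu - 1) - 4 * tau) * u <= psi (mu * u) - psi u by lra.
have D : psum (fun n => (mu * u)^-1 * Lam n) (mu * u)
   - psum (fun n => (mu * u)^-1 * Lam n) u <= Lsum (mu * u) - Lsum u.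
  apply: psum_ler => // k k0 /andP[_ ku]; have k0' : 0 < k%:R :> R by rewrite ltr0n.
  rewrite mulrC ler_wpM2l ?mangoldt_ge0 // lef_pV2 ?posrE //; lra.
rewrite !psumM -!/(psi _) in D; apply: le_trans D; rewrite -mulrBr [leRHS]mulrC.
rewrite ler_pdivlMr; last by rewrite mulr_gt0 //; lra.
apply: le_trans C; rewrite mulrA ler_pM2r // /tau; nra.
Qed.

Lemma dense_at_exists x u : 0 < u -> c <= Lsum (mu * u) - Lsum u ->
  sparse_sum lam tau x (mu * u) - sparse_sum lam tau x u < c ->
  exists n : nat, [/\ (0 < n)%N, u < n%:R <= mu * u & ~~ sparse_at lam tau x n].
Proof.
have m1 := mu1; move=> u0 A B; have uu : u <= mu * u by rewrite ler_peMl // ltW.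
have [n [n0 nu H]] := psum_exists_lt uu (lt_le_trans B A).
exists n; split=> //; apply/negP => s.
by move: H; rewrite s mulr1 ltxx.
Qed.

(** If the sparse mass were below [c], every cell and every mirror cell of mass at least [c] would
    contain a dense n. One such cell then fills all later ones to 7/5 (mu - 1), while Mertens allows
    an average of ln mu <= mu - 1. *)
Lemma sparse_window : exists M : nat, (0 < M)%N /\
  forall x w, w0 <= w -> w0 <= x / (mu ^+ M * w) ->
  c <= sparse_sum lam tau x (mu ^+ M * w) - sparse_sum lam tau x w
     + (sparse_sum lam tau x (x / w) - sparse_sum lam tau x (x / (mu ^+ M * w))).
Proof.
have m1 := mu1; have m54 := mu54; have l1 := lam1; have l2 := lam2; have w1 := w01.
(* Large enough for a mass discrepancy of 3/10 (mu - 1) per cell over K cells to exceed the Mertens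
   error 20. Below, K cells serve to find a starting cell and K more to contradict Mertens; the
   extra 1 is cell 0, as [prop] looks one cell back. *)
pose K := (truncn (100 / (mu - 1))).+1.
have KK : 100 < K%:R * (mu - 1) by rewrite -ltr_pdivrMr ?truncnS_gt //; lra.
exists (1 + K + K)%N; split=> // x w ww xw; set M := (1 + K + K)%N.
have w_gt0 : 0 < w by lra.
pose a i := mu ^+ i * w; pose H := sparse_sum lam tau x.
have aS i : a i.+1 = mu * a i by rewrite /a exprS mulrA.
have a0 i : 0 < a i by rewrite mulr_gt0 // exprn_gt0; lra.
have aSle i : a i <= a i.+1 by rewrite aS ler_peMl // ltW.
have amono : {homo a : i j / (i <= j)%N >-> i <= j}.
  by apply: homo_leq => //; exact: le_trans.
have x_gt0 : 0 < x.
  have : 0 < x / a M := lt_le_trans (lt_le_trans ltr01 w01) xw.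
  by rewrite pmulr_lgt0 // invr_gt0.
have bE i : x / a i = mu * (x / a i.+1).
  by rewrite aS; field; rewrite !gt_eqF //; lra.
have bmono i j : (i <= j)%N -> x / a j <= x / a i.
  by move=> ij; rewrite ler_pM2l // lef_pV2 ?posrE // amono.
rewrite leNgt; apply/negP; rewrite -[mu ^+ _ * _]/(a M) -/(H _) -/(H _) -/(H _).
have -> : w = a 0%N by rewrite /a mul1r.
rewrite -/(H _) => small.
have Hm u v : u <= v -> H u <= H v by apply: sparse_sum_mono.
have small1 i : (i < M)%N -> H (a i.+1) - H (a i) < c.
  move=> iM; have := Hm _ _ (amono _ _ iM); have := Hm _ _ (amono _ _ (leq0n i)).
  have := Hm _ _ (bmono _ _ (leq0n M)); lra.
have small2 i : (i < M)%N -> H (x / a i) - H (x / a i.+1) < c.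
  move=> iM; have := Hm _ _ (bmono _ _ iM); have := Hm _ _ (bmono _ _ (leq0n i)).
  have := Hm _ _ (amono _ _ (leq0n M)); lra.
pose p i := Lsum (a i.+1) - Lsum (a i).
(* A good [n] in cell [i] fills the mirror cell of [i - 1], which then contains a good
   [k], and this fills cell [i + 1]. *)
have prop i : (0 < i)%N -> (i.+2 <= M)%N -> c <= p i -> 7 / 5 * (mu - 1) <= p i.+1.
  case: i => // i _ iM; rewrite /p => pi; rewrite (aS i.+1) in pi.
  have iM1 : (i.+1 < M)%N by apply: leq_trans iM.
  have iM2 : (i.+2 <= M)%N by apply: leq_trans iM.
  have sm1 := small1 _ iM1; rewrite (aS i.+1) in sm1.
  have [n [n0 /andP[n1 n2] ngood]] := dense_at_exists (a0 _) pi sm1.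
  have n0' : 0 < n%:R :> R by rewrite ltr0n.
  have yl : x / a i.+2 <= x / n%:R by rewrite ler_pM2l // lef_pV2 ?posrE // aS.
  have full := @cell_full x n (x / a i.+1) n0.
  have {}full : 7 / 5 * (mu - 1) <= Lsum (x / a i) - Lsum (x / a i.+1).
    rewrite (bE i); apply: full => //.
    - by apply: le_trans yl; apply: le_trans xw (bmono _ _ _).
    - by rewrite ler_pM2l // lef_pV2 ?posrE // ltW.
    - have lam0 : 0 < lam by apply: lt_trans lam1.
      rewrite -(ler_pM2l lam0) in yl; apply: le_trans yl.
      have l3 : lam = mu * mu * mu by rewrite /lam; ring.
      rewrite (bE i.+1) l3 !mulrA ler_pM2r ?invr_gt0 // ler_pM2r //.
      by rewrite ler_peMr ?mulr_ge0 //; lra.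
  have sm2 := small2 _ (ltnW iM1); rewrite (bE i) in full sm2.
  have cf : c <= Lsum (mu * (x / a i.+1)) - Lsum (x / a i.+1).
    apply: le_trans full; rewrite /c; lra.
  have u0 : 0 < x / a i.+1 by rewrite divr_gt0.
  have [k [k0 /andP[k1 k2] kgood]] := dense_at_exists u0 cf sm2.
  have k0' : 0 < k%:R :> R by rewrite ltr0n.
  rewrite -(bE i) in k2.
  have yk1 : a i <= x / k%:R by rewrite ler_pdivlMr // mulrC -ler_pdivlMr.
  have yk2 : x / k%:R <= a i.+1.
    by rewrite ler_pdivrMr // mulrC -ler_pdivrMr // ltW.
  (* Here x/k may lie anywhere from [a i] to [a i.+1], and the target cell ends at [a i.+3]: this is
     why lam = mu^3. *)
  rewrite (aS i.+2); apply: (cell_full k0 _ _ _ kgood).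
  - by apply: le_trans yk1; apply: le_trans ww _; rewrite -[w]mul1r; apply: (amono 0%N).
  - exact: le_trans yk2 (aSle _).
  - have lam0 : 0 < lam by apply: lt_trans lam1.
    rewrite -(ler_pM2l lam0) in yk1; apply: le_trans yk1.
    by rewrite !aS /lam !exprS expr0 mulr1 !mulrA.
have lmu : ln mu <= mu - 1 by apply: ln_le_subr1; lra.
have lmu2 : 4 / 5 * (mu - 1) <= ln mu.
  apply: le_trans (ln_ge_1subV _); last lra.
  have : mu^-1 * mu = 1 by apply: mulVf; rewrite gt_eqF //; lra.
  have : 0 < mu^-1 by rewrite invr_gt0; lra.
  by move: (mu^-1) => z; nra.
have lna (m k : nat) : ln (a (m + k)%N) - ln (a m) = k%:R * ln mu.
  have -> : a (m + k)%N = mu ^+ k * a m by rewrite /a exprD mulrCA mulrA.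
  have muk : 0 < mu ^+ k by rewrite exprn_gt0 //; lra.
  by rewrite lnM ?posrE // addrK lnXn ?mulr_natl //; lra.
have a1 i : 1 <= a i.
  apply: le_trans w01 (le_trans ww _); rewrite -[w]mul1r; exact: (amono 0%N).
have mert (m k : nat) : `|Lsum (a (m + k)%N) - Lsum (a m) - k%:R * ln mu| <= 20.
  have := mertens_first (a1 (m + k)%N); have := mertens_first (a1 m).
  rewrite -(lna m k) !ler_norml => /andP[A B] /andP[C D]; apply/andP; split; lra.
(* Otherwise the first K cells would carry at most K (mu - 1)/2, against K ln mu >= 4/5 K (mu - 1)
   up to 20. *)
have [i0 [i01 i0K pi0]] : exists i0, [/\ (0 < i0)%N, (i0 < 1 + K)%N & c <= p i0].
  apply: contrapT => N.
  have : Lsum (a (1 + K)%N) - Lsum (a 1%N) <= K%:R * c.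
    apply: (@telescope_le (fun i => Lsum (a i))) => i /andP[i1 iK].
    rewrite leNgt; apply/negP => ci; apply: N; exists i; split=> //; exact: ltW.
  have := mert 1%N K; rewrite ler_norml /c => /andP[A _] B.
  have := ler_wpM2l (ler0n R K) lmu2; lra.
have all_full k : (i0 + k.+1 < M)%N -> 7 / 5 * (mu - 1) <= p (i0 + k.+1)%N.
  elim: k => [|k IH] H0; first by rewrite addn1; apply: prop => //; rewrite addn1 in H0.
  rewrite addnS; apply: prop; rewrite ?addn_gt0 ?i01 //; first by rewrite addnS in H0.
  by apply: le_trans (IH (ltnW _)); [rewrite /c; lra|rewrite addnS in H0].
have : K%:R * (7 / 5 * (mu - 1)) <= Lsum (a (1 + K + K)%N) - Lsum (a (1 + K)%N).
  apply: (@telescope_ge (fun i => Lsum (a i))) => i /andP[iK iM].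
  have -> : i = (i0 + (i - i0).-1.+1)%N.
    by rewrite prednK ?subn_gt0 ?(leq_trans i0K) // subnKC // ltnW // (leq_trans i0K).
  apply: all_full; rewrite prednK ?subn_gt0 ?(leq_trans i0K) //.
  by rewrite subnKC // ltnW // (leq_trans i0K).
have := mert (1 + K)%N K; rewrite ler_norml => /andP[_ A].
have := ler_wpM2l (ler0n R K) lmu; lra.
Qed.

End Window.

(** About ln x / ln B windows of ratio B fit between w0 and x/w0, each contributing [c]. Windows and
    mirrors together count each n at most twice, so without a prime power the total is at most twice
    [sparse_sum_upper]. *)
Theorem psi_gap mu : 1 < mu -> mu <= 5 / 4 ->
  exists x0 : R, forall x, x0 <= x -> psi x < psi (mu ^+ 3 * x).
Proof.
move=> mu1 mu54; set lam := mu ^+ 3; set tau := (mu - 1) / 20; set c := (mu - 1) / 2.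
have tau0 : 0 < tau by rewrite /tau; lra.
have c0 : 0 < c by rewrite /c; lra.
have lam1 : 1 < lam by rewrite exprn_egt1.
have lam2 : lam <= 2.
  apply: (@le_trans _ _ ((5 / 4) ^+ 3)); last by lra.
  by rewrite /lam lerXn2r ?nnegrE //; lra.
have [w0 w01 Hw0] := psi_short_interval_eps tau0.
have [M [M0 HM]] := sparse_window mu1 mu54 w01 Hw0.
set B := mu ^+ M in HM.
have B1 : 1 < B by rewrite exprn_egt1 // -lt0n.
have lB : 0 < ln B by apply: ln_gt0.
(* With this k, twice the upper bound is half of c ln x / ln B plus a constant; [E] is the resulting
   bound on ln x. *)
have k0 : 0 < c / (4 * ln B) by rewrite divr_gt0 // mulr_gt0.
have [C HC] := sparse_sum_upper lam1 lam2 tau0 k0.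
pose E := 2 * (ln (w0 * w0) + ln B + 2 * ln B * C / c).
exists (Num.max (w0 * w0) (expR (E + 1))) => x; rewrite ge_max => /andP[xw xE].
rewrite ltNge; apply/negP => gap.
have w0_gt0 : 0 < w0 by lra.
have ww1 : 1 <= w0 * w0 by rewrite mulr_ege1.
have x1 : 1 <= x by lra. have x0 : 0 < x by lra.
have xw0 : 1 <= x / (w0 * w0) by rewrite ler_pdivlMr ?mul1r //; lra.
have {}HC := HC x x1 gap.
have lE : E + 1 <= ln x by rewrite -[E + 1]expRK ler_ln ?posrE ?expR_gt0.
pose J := truncn (ln (x / (w0 * w0)) / ln B).
have /andP[J1 J2] : J%:R <= ln (x / (w0 * w0)) / ln B < J.+1%:R.
  by apply: truncn_itv; rewrite divr_ge0 ?ln_ge0 // ltW.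
clearbody J; rewrite ler_pdivlMr // in J1; rewrite ltr_pdivrMr // -natr1 in J2.
have BJ : B ^+ J <= x / (w0 * w0).
  have B0 : 0 < B := lt_trans ltr01 B1.
  have BJ0 : 0 < B ^+ J by rewrite exprn_gt0.
  have xw2 : 0 < x / (w0 * w0) := lt_le_trans ltr01 xw0.
  by rewrite -ler_ln ?posrE // lnXn // -mulr_natl.
pose a i := B ^+ i * w0; pose H := sparse_sum lam tau x.
have a0 i : 0 < a i by rewrite mulr_gt0 // exprn_gt0 // (lt_trans ltr01 B1).
have aS i : a i.+1 = B * a i by rewrite /a exprS mulrA.
have amono : {homo a : i j / (i <= j)%N >-> i <= j}.
  apply: homo_leq => //; first exact: le_trans.
  by move=> i; rewrite aS ler_peMl // ltW.
have aJ : w0 <= x / a J.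
  rewrite ler_pdivlMr // /a mulrC -mulrA -ler_pdivlMr // mulr_gt0 //.
(* Each window adds to both ends of H(a i) - H(x / a i), so the contributions telescope. *)
have step i : (i < J)%N -> c <= (H (a i.+1) - H (x / a i.+1)) - (H (a i) - H (x / a i)).
  move=> iJ; have := HM x (a i); rewrite -aS => A.
  have {}A := A (_ : w0 <= a i) (_ : w0 <= x / a i.+1).
  suff : c <= sparse_sum lam tau x (a i.+1) - sparse_sum lam tau x (a i) +
    (sparse_sum lam tau x (x / a i) - sparse_sum lam tau x (x / a i.+1)).
    by rewrite /H; lra.
  apply: A; first by rewrite -[w0]mul1r; apply: (amono 0%N).
  by apply: le_trans aJ _; rewrite ler_pM2l // lef_pV2 ?posrE // amono.
have := @telescope_ge (fun i => H (a i) - H (x / a i)) c 0%N J step.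
rewrite add0n => T.
have Hm u v : u <= v -> H u <= H v by apply: sparse_sum_mono.
have H0 u : 0 <= H u.
  by apply: psum_ge0 => n; rewrite mulr_ge0 ?ler0n // divr_ge0 ?mangoldt_ge0.
have A1 : H (a J) <= H x.
  apply: Hm; rewrite ler_pdivlMr // in aJ.
  by apply: le_trans aJ; rewrite ler_peMl // ltW.
have A2 : H (x / a 0%N) <= H x.
  by apply: Hm; rewrite /a mul1r ler_pdivrMr // ler_peMr // ltW.
have A3 := H0 (a 0%N); have A4 := H0 (x / a J).
have A5 : J%:R * c <= 2 * (c / (4 * ln B) * ln x + C).
  by move: HC; rewrite -/(H x); lra.
have lw : ln (x / (w0 * w0)) = ln x - ln (w0 * w0) by rewrite ln_div ?posrE //; lra.
rewrite lw in J2.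
have A6 : c * (ln x - ln (w0 * w0)) < J%:R * c * ln B + c * ln B.
  have -> : J%:R * c * ln B + c * ln B = c * ((J%:R + 1) * ln B) by ring.
  by rewrite ltr_pM2l.
have A7 : J%:R * c * ln B <= c / 2 * ln x + 2 * C * ln B.
  have := A5; rewrite -(ler_pM2r lB) => /le_trans -> //.
  rewrite le_eqVlt; apply/orP; left; apply/eqP; field; lra.
have A8 : c * ln x <= c * E.
  have -> : c * E = 2 * c * (ln (w0 * w0) + ln B) + 4 * C * ln B.
    by rewrite /E; field; lra.
  lra.
rewrite ler_pM2l // in A8; lra.
Qed.

End GapArgument.

(** * Odd prime powers just below m *)

Section Gap.
Variable R : realType.

Lemma psi_lt_prime_power (u v : R) : u <= v ->
  chebyshev_psi u < chebyshev_psi v ->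
  exists p e, [/\ prime p, (0 < e)%N & u < (p ^ e)%N%:R <= v].
Proof.
move=> uv psi_uv.
have [|n [n0 nuv Ln]] := @psum_exists_lt R (mangoldt R) (fun _ => 0) u v uv.
  by rewrite {1 2}/psum !big1 // subrr subr_gt0.
have [|p [e [pp e0 nE]]] := @mangoldt_neq0 R n; first by rewrite gt_eqF.
by exists p, e; rewrite -nE.
Qed.

(** A prime power is found in each of (u, lam u] and (lam u, lam^2 u], where m = lam^2 u. They
    cannot both be powers of 2, since lam^2 < 2. *)
Lemma odd_prime_power_gap (k : nat) : (0 < k)%N -> exists M : nat, forall m, (M <= m)%N ->
  exists p e, [/\ prime p, odd p, (0 < e)%N, (p ^ e <= m)%N & (k * m <= k * p ^ e + m)%N].
Proof.
move=> k0; have k1 : 1 <= k%:R :> R by rewrite ler1n.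
(* Makes lam^2 <= 1 + 10 d = 1 + 1/(2k), so m exceeds u by at most m/k. *)
pose d : R := (20 * k%:R)^-1.
have d0 : 0 < d by rewrite invr_gt0; lra.
have dk : d * k%:R = 1 / 20 by rewrite /d; field; lra.
have d20 : d <= 1 / 20 by rewrite -dk ler_peMr // ltW.
pose mu := 1 + d.
have [||x0 Hx0] := @psi_gap R mu; [rewrite /mu; lra|rewrite /mu; lra|].
pose lam := mu ^+ 3.
have lamE : lam = mu * mu * mu by rewrite /lam; ring.
have lam1 : 1 < lam by rewrite exprn_egt1 // /mu; lra.
have lam2 : lam * lam <= 1 + 10 * d.
  have a2 : mu * mu <= 1 + 21 / 10 * d by rewrite /mu; nra.
  have a3 : lam <= 1 + 33 / 10 * d by rewrite lamE /mu; nra.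
  nra.
clearbody d; rewrite -/lam in Hx0; clearbody lam mu.
exists (Num.truncn (lam * lam * Num.max x0 1)).+1 => m mM.
have [u [u0 ux mE]] : exists u, [/\ 0 < u, x0 <= u & m%:R = lam * (lam * u)].
  exists (m%:R / (lam * lam)); split; last by field; lra.
  - by rewrite divr_gt0 ?ltr0n ?mulr_gt0 //; [exact: leq_ltn_trans mM|lra|lra].
  rewrite ler_pdivlMr; last by rewrite mulr_gt0; lra.
  rewrite mulrC; apply: le_trans (_ : lam * lam * Num.max x0 1 <= _).
    by rewrite ler_pM2l ?mulr_gt0 ?le_max ?lexx //; lra.
  apply: le_trans (ltW (truncnS_gt _)) _; by rewrite ler_nat.
have ul : u <= lam * u by rewrite ler_peMl // ltW.
have ull : lam * u <= lam * (lam * u) by rewrite ler_pM2l //; lra.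
have [p [e [pp e0 /andP[q1 q2]]]] := psi_lt_prime_power ul (Hx0 _ ux).
have [p' [e' [pp' e0' /andP[q1' q2']]]] :=
  psi_lt_prime_power ull (Hx0 _ (le_trans ux ul)).
rewrite -mE in q2'.
have good n : u < n%:R -> (k * m <= k * n + m)%N.
  move=> un; rewrite -(ler_nat R) natrD !natrM mE.
  have A : k%:R * (lam * lam) <= k%:R + lam * lam.
    have : k%:R * (lam * lam) <= k%:R * (1 + 10 * d) by rewrite ler_wpM2l.
    have : 1 <= lam * lam by nra.
    lra.
  have B : k%:R * u <= k%:R * n%:R by rewrite ler_wpM2l // ltW.
  have : u * (k%:R * (lam * lam)) <= u * (k%:R + lam * lam) by rewrite ler_pM2l.
  lra.
have pos (s t : nat) : prime s -> odd s || (s == 2).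
  by move=> ps; case: (even_prime ps) => ->; rewrite ?eqxx ?orbT.
have [op|] := orP (pos p e pp).
  exists p, e; split=> //; last exact: good.
  by rewrite -(ler_nat R) mE; apply: le_trans q2 ull.
have [op'|] := orP (pos p' e pp').
  exists p', e'; split=> //; last by apply: good; apply: le_lt_trans q1'.
  by rewrite -(ler_nat R).
move=> /eqP p2' /eqP p2; exfalso; subst p p'.
have ee : (e < e')%N.
  by rewrite -(ltn_exp2l e e' (isT : (1 < 2)%N)) -(ltr_nat R); apply: le_lt_trans q1'.
have : (2 * 2 ^ e <= 2 ^ e')%N by rewrite -expnS leq_exp2l.
rewrite -(ler_nat R) natrM => H.
have : lam * lam * u < 2 * u by rewrite ltr_pM2r //; lra.
rewrite mE in q2'; lra.
Qed.

End Gap.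

(** * The theorem *)

Import numFieldNormedType.Exports.
Local Open Scope classical_set_scope.

(** Rules out the default value of [xget] by exhibiting a least element. *)
Lemma multipartite_ramseyP (k m : nat) (H : sgraph) (n : nat) :
  multipartite_arrows k m H n ->
  multipartite_arrows k m H (multipartite_ramsey k m H) /\
  (multipartite_ramsey k m H <= n)%N.
Proof.
move=> arr.
have ex : exists n, `[< multipartite_arrows k m H n >] by exists n; apply/asboolP.
pose n0 := ex_minn ex.
have n0P : [set n | multipartite_arrows k m H n /\
    forall n', multipartite_arrows k m H n' -> (n <= n')%N] n0.
  rewrite /n0; case: ex_minnP => x /asboolP xa xm; split=> // y ya.
  by apply: xm; apply/asboolP.
have [rarr rmin] : [set n | multipartite_arrows k m H n /\
    forall n', multipartite_arrows k m H n' -> (n <= n')%N] (multipartite_ramsey k m H).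
  exact: (xgetI 0%N n0P).
by split=> //; apply: rmin.
Qed.

Lemma ramsey_K33_upper (m : nat) : (0 < m)%N ->
  multipartite_arrows 3 m K33 (multipartite_ramsey 3 m K33) /\
  (2 * multipartite_ramsey 3 m K33 <= m ^ 3 + 17 * m ^ 2)%N.
Proof.
move=> m0; pose N := (m ^ 3 + 12 * m ^ 2 + 3 * m)%N.
have [|arr le] := @multipartite_ramseyP 3 m K33 (N %/ 2).+1.
  by apply: arrows_K33; rewrite // -/N; lia.
split=> //; apply: leq_trans (_ : N + 2 <= _)%N; first by lia.
rewrite /N; move: (m ^ 3)%N => x; nia.
Qed.

(** The norm colouring is used with s = k and q the odd prime power just below m - D. The 8 is 6 for
    the digit colours, 1 for the gap below m - D, and 1 absorbing bounded terms for large m. *)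
Lemma ramsey_K33_lower (R : realType) (k : nat) : (8 <= k)%N ->
  exists M : nat, forall m, (M <= m)%N ->
    ((k - 8) ^ 3 * m ^ 3 <= k ^ 3 * (2 * multipartite_ramsey 3 m K33))%N.
Proof.
have sqrS x : (x ^ 2 <= x.+1 ^ 2 - 1)%N by nia.
move=> k8; have k0 : (0 < k)%N by apply: leq_trans k8.
have [M HM] := @odd_prime_power_gap R k k0.
exists (k * (2 * M + 3 * k ^ 2 + 4) + 1)%N => m mM.
have m0 : (0 < m)%N by apply: leq_trans mM; rewrite addn1.
have [arr _] := ramsey_K33_upper m0; set r := multipartite_ramsey _ _ _ in arr *.
(* The number of colours reserved for degenerate edges: three palettes of 2 (m / k) + k^2 + 1. *)
pose D := (6 * (m %/ k) + 3 * k ^ 2 + 3)%N.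
have kD : (k * D <= 6 * m + k * (3 * k ^ 2 + 3))%N.
  have := leq_divM m k; rewrite /D; move: (m %/ k)%N (k ^ 2)%N => a b; nia.
have Mm : (M <= m - D)%N.
  move: kD mM; rewrite /D; move: (m %/ k)%N (k ^ 2)%N; clear -k8; move=> a b; nia.
have Dm : (D <= m)%N.
  move: kD mM; rewrite /D; move: (m %/ k)%N (k ^ 2)%N; clear -k8; move=> a b; nia.
have [p [e [pp oddp e0 qm mq]]] := HM _ Mm.
set q := (p ^ e)%N in qm mq.
have q0 : (0 < q)%N by rewrite expn_gt0 prime_gt0.
have small : (q.-1 + 3 * (2 * (q.-1 %/ k) + k ^ 2).+1 <= m)%N.
  have : (q.-1 %/ k <= m %/ k)%N.
    by apply: leq_div2r; rewrite (leq_trans (leq_pred _)) // (leq_trans qm) // leq_subr.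
  move: qm Dm; rewrite /D; move: (q.-1 %/ k)%N (m %/ k)%N (k ^ 2)%N => a b c; lia.
have big : ((q ^ 2 - 1) * q.-1 < 2 * r)%N.
  by rewrite ltnNge; apply/negP => H; apply: (not_arrows_K33 pp oddp e0 k0 small H arr).
have cube : (q.-1 ^ 3 <= 2 * r)%N.
  apply: leq_trans (ltnW big); case: (q) => // x; rewrite /= [in leqLHS]expnSr.
  by rewrite leq_mul2r sqrS orbT.
have lin : ((k - 8) * m <= k * q.-1)%N.
  have : (k * (m - D) <= k * q.-1 + k + m)%N.
    rewrite -mulnSr prednK //; apply: leq_trans mq _.
    by rewrite leq_add2l leq_subr.
  move: kD mM; rewrite mulnBr mulnBl !mulnDr mulnCA.
  move: (k * m)%N (k * D)%N (k * q.-1)%N (k * k ^ 2)%N (k * M)%N => *; lia.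
rewrite -expnMn; apply: leq_trans (_ : (k * q.-1) ^ 3 <= _)%N; first by rewrite leq_exp2r.
by rewrite expnMn leq_mul2l cube orbT.
Qed.

Unset Implicit Arguments.

Theorem theorem1p7 (R : realType) :
  exists2 eps : nat -> R, eps m @[m --> \oo] --> (0 : R) &
    forall m : nat, (1 <= m)%N ->
      (multipartite_ramsey 3 m K33)%:R = (1 / 2 + eps m) * m%:R ^+ 3 :> R.
Proof.
pose r m : R := (multipartite_ramsey 3 m K33)%:R.
exists (fun m => r m / m%:R ^+ 3 - 1 / 2); last first.
  move=> m m1; have m0 : m%:R != 0 :> R by rewrite pnatr_eq0 -lt0n.
  by rewrite -/(r m); field.
apply/cvgrPdist_le => d d0.
(* Then (1 - 8/k)^3 >= 1 - 24/k >= 1 - 2d; the bounds concern 2r, hence 2d. *)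
pose k := (Num.truncn (12 / d) + 8)%N.
have k8 : (8 <= k)%N by rewrite leq_addl.
have kd : 12 <= d * k%:R.
  rewrite mulrC -ler_pdivrMr //; apply: le_trans (ltW (truncnS_gt _)) _.
  by rewrite ler_nat /k addnS ltnS leq_addr.
have [M HM] := ramsey_K33_lower R k8.
(* The second threshold makes the upper error 17/m at most 1/k, hence below 2d. *)
exists (maxn M (k * 17)).+1 => // m /= Mm.
have m1 : (0 < m)%N by apply: leq_trans Mm.
have Mm' : (M <= m)%N by apply: ltnW; apply: leq_ltn_trans Mm; rewrite leq_maxl.
have km : (k * 17 <= m)%N by apply: ltnW; apply: leq_ltn_trans Mm; rewrite leq_maxr.
have m0 : 0 < m%:R :> R by rewrite ltr0n.
have m30 : 0 < m%:R ^+ 3 :> R by rewrite exprn_gt0.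
have [_ up] := ramsey_K33_upper m1.
have lo := HM m Mm'.
have {}up : 2 * r m <= m%:R ^+ 3 + 17 * m%:R ^+ 2.
  by rewrite /r -!natrX -!natrM -natrD ler_nat.
have {}lo : (k%:R - 8) ^+ 3 * m%:R ^+ 3 <= k%:R ^+ 3 * (2 * r m).
  by rewrite /r -(natrB _ k8) -!natrX -!natrM ler_nat.
have {}km : k%:R * 17 <= m%:R :> R by rewrite -natrM ler_nat.
have {}k8 : 8 <= k%:R :> R by rewrite ler_nat.
move: (r m) (m%:R : R) (k%:R : R) m0 m30 up lo km k8 kd => {HM Mm Mm' m1}.
move=> {r m k M} s m k m0 m30 up lo km k8 kd.
rewrite sub0r normrN ler_norml; apply/andP; split.
  rewrite lerBrDl ler_pdivlMr //.
  have k3 : 0 < k ^+ 3 by rewrite exprn_gt0 //; lra.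
  have k33 : (1 - 2 * d) * k ^+ 3 <= (k - 8) ^+ 3.
    have : 24 * k ^+ 2 <= 2 * d * k ^+ 3.
      rewrite !exprS expr0; nra.
    nra.
  have : (1 - 2 * d) * k ^+ 3 * m ^+ 3 <= k ^+ 3 * (2 * s).
    by apply: le_trans lo; rewrite ler_pM2r.
  rewrite [(1 - 2 * d) * _]mulrC -mulrA ler_pM2l //; lra.
rewrite lerBlDr ler_pdivrMr //.
have : 17 * m ^+ 2 <= 2 * d * m ^+ 3.
  rewrite !exprS expr0; nra.
lra.
Qed.
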